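(* The Banach space $JH\tilde{\otimes}_\epsilon JH$, where $JH$ is the James Hagler space, fails property (u).
   Context: **Property (u).** A series $\sum x_n$ in a Banach space $E$ is called weakly unconditionally Cauchy (wuC) if there is a constant $K<\infty$ such that $\|\sum_{n=1}^k \epsilon_n x_n\|\le K$ for all choices of signs $\epsilon_n=\pm1$ and all $k\in\mathbb{N}$. A Banach space $E$ has property (u) if whenever $(x_n)$ is a weakly Cauchy sequence in $E$, there is a wuC series $\sum y_k$ in $E$ such that $x_n-\sum_{k=1}^n y_k\to 0$ weakly as $n\to\infty$. **Tensor product.** If $E$ and $F$ are Banach spaces with $E'$ the dual of $E$, let $L(E',F)$ be the space of all bounded linear operators from $E'$ into $F$ with the operator norm. Then $E\tilde{\otimes}_\epsilon F$ is the closed subspace of $L(E',F)$ generated by the weak*-weakly continuous operators of finite rank. **The space $JH$.** Let $T=\bigcup_{n=0}^\infty\{0,1\}^n$ be the dyadic tree; its elements are called nodes. A node $\phi=(\epsilon_i)_{i=1}^n$ has length $|\phi|=n$ (the empty node has length $0$). For $\phi=(\epsilon_i)_{i=1}^n$ and $\psi=(\delta_i)_{i=1}^m$ in $T$, write $\phi\le\psi$ if $n\le m$ and $\epsilon_i=\delta_i$ for $1\le i\le n$ (the empty node is $\le$ every node). For $\phi\le\psi$ the set $S(\phi,\psi)=\{\xi\in T:\phi\le\xi\le\psi\}$ is called a segment, more specifically an $m$-$n$ segment if $|\phi|=m$ and $|\psi|=n$. A set of segments $\{S_1,\dots,S_r\}$ is admissible if the $S_i$ are pairwise disjoint and there are $m,n\in\mathbb{N}\cup\{0\}$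 such that each $S_i$ is an $m$-$n$ segment. For a finitely supported function $x:T\to\mathbb{R}$ and a segment $S$, put $Sx=\sum_{\phi\in S}x(\phi)$. The James Hagler space $JH$ is the completion of the space of all finitely supported functions $x:T\to\mathbb{R}$ under the norm $$\|x\|=\sup\left\{\sum_{i=1}^r|S_ix| : S_1,\dots,S_r \text{ is an admissible set of segments}\right\}.$$ *)

(* Defs.v *)
From HB Require Import structures.
From mathcomp Require Import all_boot all_order all_algebra.
From mathcomp Require Import all_classical all_reals.
From mathcomp Require Import topology normedtype sequences.

Set Implicit Arguments.
Unset Strict Implicit.
Unset Printing Implicit Defensive.

Import Order.TTheory GRing.Theory Num.Theory.
Import numFieldNormedType.Exports.

Local Open Scope classical_set_scope.
Local Open Scope ring_scope.

Section InitialTopology.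

Lemma initial_cvgP (S : choiceType) (T : topologicalType) (g : S -> T)
    (G : set_system S) (s : S) : Filter G ->
  G --> (s : initial_topology g) <-> (g @ G) --> g s.
Proof.
move=> FG; split=> [Gs|gGs].
  exact: cvg_trans (cvg_app g Gs) (@initial_continuous _ _ g s).
move=> A [B [[C oC <-] Cs CA]].
apply: filterS CA _; apply: gGs; exact: open_nbhs_nbhs.
Qed.

Lemma initial_cauchyP (S : choiceType) (U : uniformType) (g : S -> U)
    (G : set_system S) : Filter G ->
  cauchy (G : set_system (initial_topology g)) <-> cauchy (g @ G).
Proof.
move=> FG; split=> cG A.
  move=> entA; have [|[P Q] [/= GP GQ] PQ] := cG ((fun p : S * S => (g p.1, g p.2)) @^-1` A).
    by exists A.
  exists (g @` P, g @` Q) => /=.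
    by split; [apply: filterS GP|apply: filterS GQ] => s; exists s.
  by move=> [_ _] [/= [p Pp <-] [q Qq <-]]; exact: (PQ (p, q)).
move=> [B entB BA]; have [[P Q] [/= GP GQ] PQ] := cG _ entB.
by exists (g @^-1` P, g @^-1` Q) => // -[p q] /= pq; apply: BA; exact: (PQ (g p, g q)).
Qed.

Lemma sup_topology_cauchyP (T : choiceType) (I : Type) (Tc : I -> Uniform T)
    (G : set_system T) : Filter G ->
  cauchy (G : set_system (sup_topology Tc)) <->
  forall i, cauchy (G : set_system (Uniform.Pack (Tc i))).
Proof.
move=> FG; split=> [cG i A entA|cG A [_ [X _ <-] XA]].
  apply: cG.
  have entP : `[< @entourage (Uniform.Pack (Tc i)) A >] by apply/asboolP.
  exists A => //; pose p := exist (fun p : {classic I} * set (T * T) =>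
    `[< @entourage (Uniform.Pack (Tc p.1)) p.2 >]) (i, A) entP.
  exact: (@finI_from1 _ _ [set: {p : {classic I} * set (T * T) |
    `[< @entourage (Uniform.Pack (Tc p.1)) p.2 >]}] (fun q => (projT1 q).2) p).
apply: filterS XA _; apply: filter_bigI => -[[i B] /= /asboolP entB] _.
exact: (cG i B entB).
Qed.

Lemma ptws_cauchyP (D : Type) (U : uniformType)
    (G : set_system {ptws D -> U}) : Filter G ->
  cauchy G <-> forall t : D, cauchy (@proj D (fun=> U) t @ G).
Proof.
move=> FG; rewrite /cauchy.
have -> : @entourage {ptws D -> U} = @entourage (sup_topology (fun t : D =>
  Uniform.class (initial_topology (@proj D (fun=> U) t)))) by [].
have := @sup_topology_cauchyP _ _ (fun t : D => Uniform.class
  (initial_topology (@proj D (fun=> U) t))) G FG.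
rewrite /cauchy => ->; split=> H t.
  by move/(@initial_cauchyP _ _ (@proj D (fun=> U) t)) : (H t).
by apply/(@initial_cauchyP _ _ (@proj D (fun=> U) t)); exact: H.
Qed.

End InitialTopology.

Section BoundedOperators.
Context (R : realType) (E F : normedModType R).

Definition bounded_operator : {pred E -> F} := fun f =>
  `[< linear f /\ exists M : R, forall x, `|f x| <= M * `|x| >].

Fact bounded_operator_submod_closed : submod_closed bounded_operator.
Proof.
split=> [|a f g /asboolP[lf [M Mf]] /asboolP[lg [N Ng]]].
  apply/asboolP; split=> [c x y|]; first by rewrite /= scaler0 addr0.
  by exists 0 => x; rewrite normr0 mul0r.
apply/asboolP; split=> [c x y|].
  rewrite /= -![(_ + _ : E -> F) _]/(_ + _ : F).
  rewrite -![(_ *: _ : E -> F) _]/(_ *: _ : F) lf lg.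
  by rewrite !scalerDr !scalerA (mulrC a c) addrACA.
exists (`|a| * M + N) => x; rewrite (le_trans (ler_normD _ _))//.
by rewrite mulrDl lerD// normrZ -mulrA ler_wpM2l.
Qed.

HB.instance Definition _ := GRing.isSubmodClosed.Build _ _ bounded_operator
  bounded_operator_submod_closed.

Record operator := Operator
  { operator_fun :> E -> F; _ : operator_fun \in bounded_operator }.

HB.instance Definition _ := [isSub for operator_fun].
HB.instance Definition _ := [Choice of operator by <:].
HB.instance Definition _ := [SubChoice_isSubLmodule of operator by <:].

Lemma operator_linear (f : operator) : linear f.
Proof. by have /asboolP[] := valP f. Qed.

HB.instance Definition _ (f : operator) :=
  GRing.isLinear.Build R E F *:%R (operator_fun f) (operator_linear f).

Definition opnorm (f : operator) : R :=
  sup [set `|f x| | x in [set x | `|x| <= 1]].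

Lemma opnorm_has_sup (f : operator) :
  has_sup [set `|f x| | x in [set x | `|x| <= 1]].
Proof.
split; first by exists `|f 0|, 0 => //=; rewrite normr0.
have /asboolP[_ [M Mf]] := valP f; exists `|M| => _ [x /= x1 <-].
rewrite (le_trans (Mf x))// (le_trans (ler_norm _))// normrM normr_id.
by rewrite ler_piMr.
Qed.

Lemma ler_opnorm (f : operator) x : `|f x| <= opnorm f * `|x|.
Proof.
have [->|x0] := eqVneq x 0; first by rewrite linear0 !normr0 mulr0.
have nx : 0 < `|x| by rewrite normr_gt0.
rewrite -ler_pdivrMr//; apply: sup_upper_bound; first exact: opnorm_has_sup.
exists (`|x|^-1 *: x); last first.
  by rewrite linearZ/= normrZ normfV normr_id mulrC.
by rewrite /= normrZ normfV normr_id mulVf ?gt_eqF.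
Qed.

Lemma opnorm_le (f : operator) M : 0 <= M ->
  (forall x, `|f x| <= M * `|x|) -> opnorm f <= M.
Proof.
move=> M0 Mf; apply: ge_sup; first by case: (opnorm_has_sup f).
by move=> _ [x /= x1 <-]; rewrite (le_trans (Mf x))// ler_piMr.
Qed.

Lemma opnorm_ge0 (f : operator) : 0 <= opnorm f.
Proof.
rewrite (le_trans (normr_ge0 (f 0)))//.
apply: sup_upper_bound; first exact: opnorm_has_sup.
by exists 0 => //=; rewrite normr0.
Qed.

Fact opnormD f g : opnorm (f + g) <= opnorm f + opnorm g.
Proof.
apply: opnorm_le => [|x]; first by rewrite addr_ge0 ?opnorm_ge0.
by rewrite (le_trans (ler_normD _ _))// mulrDl lerD// ler_opnorm.
Qed.

Fact opnormZ (a : R) f : opnorm (a *: f) = `|a| * opnorm f.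
Proof.
have le b g : opnorm (b *: g) <= `|b| * opnorm g.
  apply: opnorm_le => [|x]; first by rewrite mulr_ge0 ?opnorm_ge0.
  by rewrite -mulrA -[(_ *: _ : operator) x]/(b *: g x) normrZ ler_wpM2l ?ler_opnorm.
apply/eqP; rewrite eq_le le /=.
have [->|a0] := eqVneq a 0; first by rewrite normr0 mul0r opnorm_ge0.
rewrite -ler_pdivlMl ?normr_gt0// -normfV.
by apply: le_trans (le _ _); rewrite scalerA mulVf// scale1r.
Qed.

Fact opnorm_eq0 f : opnorm f = 0 -> f = 0.
Proof.
move=> f0; apply/val_inj/funext => x; apply/eqP; rewrite -normr_le0.
by rewrite (le_trans (ler_opnorm f x))// f0 mul0r.
Qed.

HB.instance Definition _ :=
  Lmodule_isNormed.Build R operator opnormD opnormZ opnorm_eq0.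

Lemma opnormE (f : operator) : `|f| = opnorm f. Proof. by []. Qed.

End BoundedOperators.

Section OperatorComplete.
Context (R : realType) (E : normedModType R) (F : completeNormedModType R).

Fact operator_complete (G : set_system (operator E F)) :
  ProperFilter G -> cauchy G -> cvg G.
Proof.
move=> PG /cauchyP cG.
have ev x : cvg ((fun f : operator E F => f x) @ G).
  apply: cauchy_cvg; apply: cauchy_exP => e e0.
  have x1 : 0 < `|x| + 1 by rewrite ltr_wpDl.
  have [f0 Gf0] := cG _ (divr_gt0 e0 x1).
  exists (f0 x); rewrite -[_ _]/(G [set f | ball (f0 x) e (f x)]).
  apply: filterS Gf0 => f /=; rewrite -!ball_normE/= => ff0.
  rewrite -[f0 x - f x]/((f0 - f) x) (le_lt_trans (ler_opnorm _ _))//.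
  rewrite -opnormE; have [->|nx] := eqVneq `|x| 0; first by rewrite mulr0.
  rewrite (lt_le_trans (y := e / (`|x| + 1) * `|x|))//.
    by rewrite ltr_pM2r// lt_neqAle eq_sym nx /=.
  by rewrite -mulrA ler_piMr ?ltW// ltr_pdivrMl// mulr1 ltrDl.
pose g x := lim ((fun f : operator E F => f x) @ G).
have gE x : (fun f : operator E F => f x) @ G --> g x by exact: ev.
have glin : linear g.
  move=> a x y; apply: (cvg_lim (@norm_hausdorff _ F)).
  rewrite (_ : (fun f : operator E F => f (a *: x + y)) =
    (fun f => a *: f x + f y)); last by apply/funext => f; rewrite linearP.
  by apply: cvgD => //; apply: cvgZl_tmp.
have bnd f0 e : G (ball f0 e) -> forall x, `|f0 x - g x| <= e * `|x|.
  move=> Gf0 x.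
  have c : (fun f : operator E F => `|f0 x - f x|) @ G --> `|f0 x - g x|.
    by apply: cvg_norm; apply: cvgB => //; exact: cvg_cst.
  apply: (@closed_cvg _ _ G _ (fun f : operator E F => `|f0 x - f x|)
    [set z | z <= e * `|x|]) c => //.
  apply: filterS Gf0 => f; rewrite -ball_normE/= => /ltW ff0.
  rewrite -[f0 x - f x]/((f0 - f) x) (le_trans (ler_opnorm _ _))//.
  by rewrite ler_wpM2r.
have gb : g \in @bounded_operator R E F.
  apply/asboolP; split=> //; have [f0 /bnd f0g] := cG _ ltr01.
  exists (1 + opnorm f0) => x; rewrite mulrDl -lerBlDr.
  apply: le_trans (f0g x); rewrite distrC; apply: le_trans (lerB_dist _ _).
  by rewrite lerB// ler_opnorm.
apply/cvg_ex; exists (Operator gb); apply/cvgrPdist_le => e e0.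
have e20 : 0 < e / 2 by rewrite divr_gt0.
have [f0 Gf0] := cG _ e20; have f0g := bnd _ _ Gf0.
apply: filterS Gf0 => f; rewrite -ball_normE/= => /ltW ff0.
apply: opnorm_le => [|x]; first exact: ltW.
rewrite -[X in `|X|]/(g x - f x) -(subrKA (f0 x)) (splitr e) mulrDl.
rewrite (le_trans (ler_normD _ _))// lerD//; first by rewrite distrC.
by rewrite -[f0 x - f x]/((f0 - f) x) (le_trans (ler_opnorm _ _))// ler_wpM2r.
Qed.

HB.instance Definition _ :=
  Uniform_isComplete.Build (operator E F) operator_complete.

End OperatorComplete.

Section Weak.
Context (R : realType).

Definition dual (E : normedModType R) : completeNormedModType R :=
  operator E R^o.

Definition weak (E : normedModType R) := initial_topology
  ((fun x f => f x) : E -> {ptws dual E -> R}).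

Definition weak_star (E : normedModType R) := initial_topology
  ((fun f x => f x) : dual E -> {ptws E -> R}).

(* the n-th sign is (-1) ^+ eps n *)
Definition wuC (E : normedModType R) (y : nat -> E) : Prop :=
  exists K : R, forall (eps : nat -> bool) (k : nat),
    `|\sum_(n < k) (-1) ^+ eps n *: y n| <= K.

(* sequences are indexed from 0, so that the n-th partial sum has n.+1 terms *)
Definition property_u (E : completeNormedModType R) : Prop :=
  forall x : nat -> E, cauchy ((x : nat -> weak E) @ \oo) ->
  exists2 y : nat -> E, wuC y &
    ((fun n => x n - \sum_(k < n.+1) y k) : nat -> weak E) @ \oo
      --> (0 : weak E).

Lemma weak_cvgP (E : normedModType R) (G : set_system E) (l : E) : Filter G ->
  G --> (l : weak E) <-> forall f : dual E, f @ G --> f l.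
Proof.
move=> FG; apply: (iff_trans (@initial_cvgP _ _ _ G l _)).
apply: (iff_trans (cvg_sup _ _ _)).
split=> H f; have := H f.
  by move/initial_cvgP.
by move=> ?; apply/initial_cvgP.
Qed.

Lemma weak_cauchyP (E : normedModType R) (G : set_system E) : Filter G ->
  cauchy (G : set_system (weak E)) <-> forall f : dual E, cauchy (f @ G).
Proof.
move=> FG; apply: (iff_trans (@initial_cauchyP _ _ _ G _)).
exact: ptws_cauchyP.
Qed.

End Weak.

Section ClosedSpan.
Context (R : realType) (V : normedModType R).

Definition linear_subspace (W : set V) : Prop :=
  W 0 /\ forall (a : R) u v, W u -> W v -> W (a *: u + v).

Definition closed_span (A : set V) : set V :=
  smallest [set W | closed W /\ linear_subspace W] A.

Lemma closed_span_closed (A : set V) : closed (closed_span A).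
Proof. by apply: closed_bigI => W [[]]. Qed.

Lemma closed_span_linear (A : set V) : linear_subspace (closed_span A).
Proof.
split=> [W [[_ []]]//|a u v Au Av W AW].
by have [[_ [_ +]] _] := AW; apply; [exact: Au|exact: Av].
Qed.

Context (A : set V).

Definition in_closed_span : {pred V} := fun u => u \in closed_span A.

Fact in_closed_span_submod_closed : submod_closed in_closed_span.
Proof.
have [A0 AD] := closed_span_linear A.
split=> [|a u v]; rewrite !unfold_in ?inE//; exact: AD.
Qed.

HB.instance Definition _ := GRing.isSubmodClosed.Build _ _ in_closed_span
  in_closed_span_submod_closed.

Record closed_span_of := ClosedSpan
  { closed_span_val :> V; _ : closed_span_val \in in_closed_span }.

HB.instance Definition _ := [isSub for closed_span_val].
HB.instance Definition _ := [Choice of closed_span_of by <:].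
HB.instance Definition _ := [SubChoice_isSubLmodule of closed_span_of by <:].

Definition closed_span_norm (u : closed_span_of) : R := `|val u|.

Fact closed_span_normD u v :
  closed_span_norm (u + v) <= closed_span_norm u + closed_span_norm v.
Proof. exact: ler_normD. Qed.

Fact closed_span_normZ (a : R) u :
  closed_span_norm (a *: u) = `|a| * closed_span_norm u.
Proof. exact: normrZ. Qed.

Fact closed_span_norm_eq0 u : closed_span_norm u = 0 -> u = 0.
Proof. by move/eqP; rewrite normr_eq0 => /eqP u0; exact/val_inj. Qed.

HB.instance Definition _ := Lmodule_isNormed.Build R closed_span_of
  closed_span_normD closed_span_normZ closed_span_norm_eq0.

End ClosedSpan.

Section ClosedSpanComplete.
Context (R : realType) (V : completeNormedModType R) (A : set V).

Fact closed_span_complete (G : set_system (closed_span_of A)) :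
  ProperFilter G -> cauchy G -> cvg G.
Proof.
move=> PG /cauchyP cG.
have /cvg_ex[l Gl] : cvg ((fun u : closed_span_of A => val u) @ G).
  apply: cauchy_cvg; apply: cauchy_exP => e e0; have [u0 Gu0] := cG _ e0.
  by exists (val u0); rewrite -!ball_normE/= in Gu0 *.
have lA : l \in in_closed_span A.
  rewrite unfold_in inE.
  apply: (@closed_cvg _ _ G _ (fun u : closed_span_of A => val u)
    (closed_span A)) Gl; first exact: closed_span_closed.
  by apply: nearW => u; have := valP u; rewrite unfold_in inE.
apply/cvg_ex; exists (ClosedSpan lA); apply/cvgrPdist_le => e e0.
by move/cvgrPdist_le : Gl => /(_ _ e0).
Qed.

HB.instance Definition _ :=
  Uniform_isComplete.Build (closed_span_of A) closed_span_complete.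

End ClosedSpanComplete.

Section InjectiveTensor.
Context (R : realType) (E F : normedModType R).

Definition finite_rank (T : dual E -> F) : Prop :=
  exists n (y : 'I_n -> F), forall f, exists a : 'I_n -> R,
    T f = \sum_i a i *: y i.

Definition weak_star_weak_continuous (T : dual E -> F) : Prop :=
  continuous (T : weak_star E -> weak F).

End InjectiveTensor.

Definition injective_tensor (R : realType) (E F : completeNormedModType R) :
    completeNormedModType R :=
  @closed_span_of R (operator (dual E) F)
    [set T : operator (dual E) F |
      finite_rank T /\ weak_star_weak_continuous T].

Section Completion.
Context (R : realType) (X : normedModType R).

Fact eval_bounded (x : X) :
  (fun f : dual X => f x : R^o) \in @bounded_operator R (dual X) R^o.
Proof.
apply/asboolP; split=> [a f g//|]; exists `|x| => f.
by rewrite mulrC; exact: ler_opnorm.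
Qed.

Definition bidual_eval (x : X) : dual (dual X) := Operator (eval_bounded x).

(* The completion is realized as the closure of the canonical image of X in its
   bidual. For the space c00 below, JH_isometry and to_completion_dense show
   that to_completion is isometric with dense range. *)
Definition completion : completeNormedModType R :=
  closed_span_of (range bidual_eval).

Fact to_completion_subproof x : bidual_eval x \in in_closed_span (range bidual_eval).
Proof. by rewrite unfold_in inE; apply: sub_gen_smallest; exists x. Qed.

Definition to_completion (x : X) : completion :=
  ClosedSpan (to_completion_subproof x).

Fact to_completion_linear : linear to_completion.
Proof.
move=> a x y; apply/val_inj/val_inj/funext => f.
by rewrite /= linearP.
Qed.

HB.instance Definition _ := GRing.isLinear.Build R X completion *:%R
  to_completion to_completion_linear.

End Completion.

Definition node : Type := seq bool.
HB.instance Definition _ := Choice.on node.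

(* phi <= psi in the dyadic tree is [prefix phi psi], and |phi| is [size phi] *)
Definition segment (phi psi : node) : set node :=
  [set xi : node | prefix phi xi && prefix xi psi].

Definition mn_segment (m n : nat) (S : set node) : Prop :=
  exists phi psi, [/\ prefix phi psi, size phi = m, size psi = n &
    S = segment phi psi].

(* The empty family (r = 0) is allowed: it contributes 0 to the supremum of
   nonnegative numbers defining the norm, which is thus unchanged. *)
Definition admissible (r : nat) (S : 'I_r -> set node) : Prop :=
  trivIset setT S /\ exists m n, forall i, mn_segment m n (S i).

Section JamesHagler.
Context (R : realType).

Definition finitely_supported : {pred node -> R} := fun x =>
  `[< finite_set [set phi | x phi != 0] >].

Fact finitely_supported_submod_closed : submod_closed finitely_supported.
Proof.
split=> [|a x y /asboolP fx /asboolP fy]; apply/asboolP.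
  apply: (@sub_finite_set _ _ set0) => // phi /=; rewrite /GRing.zero/=.
  by rewrite eqxx.
apply: (@sub_finite_set _ _ ([set phi | x phi != 0] `|` [set phi | y phi != 0])).
  move=> phi /=; apply: contra_neqP => /not_orP[/negP/negPn/eqP xp].
  by move=> /negP/negPn/eqP yp; rewrite /GRing.add/= /GRing.scale/= xp yp scaler0 addr0.
by rewrite finite_setU.
Qed.

HB.instance Definition _ := GRing.isSubmodClosed.Build _ _ finitely_supported
  finitely_supported_submod_closed.

Record c00 := C00 { c00_fun :> node -> R; _ : c00_fun \in finitely_supported }.

HB.instance Definition _ := [isSub for c00_fun].
HB.instance Definition _ := [Choice of c00 by <:].
HB.instance Definition _ := [SubChoice_isSubLmodule of c00 by <:].

(* finitely supported sum; S x in the literature *)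
Definition segment_sum (S : set node) (x : c00) : R := \sum_(phi \in S) x phi.

Definition JH_sums (x : c00) : set R :=
  [set v | exists r (S : 'I_r -> set node),
     admissible S /\ v = \sum_i `|segment_sum (S i) x|].

Definition JH_norm (x : c00) : R := sup (JH_sums x).

Lemma segment_sumE (r : seq node) (x : c00) S : uniq r ->
  (forall phi, phi \notin r -> x phi = 0) ->
  segment_sum S x = \sum_(phi <- r | phi \in S) x phi.
Proof. by move=> ur xr; rewrite bigfs ?set_mem_set// => phi _ /xr. Qed.

Lemma c00_support (x : c00) : exists2 r : seq node, uniq r &
  forall phi, phi \notin r -> x phi = 0.
Proof.
have /asboolP/finite_seqP[s xs] := valP x.
exists (undup s) => [|phi]; first exact: undup_uniq.
rewrite mem_undup => phis; apply/eqP; apply: contraNT phis => xphi.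
by have : [set phi | x phi != 0] phi by []; rewrite xs.
Qed.

Fact segment_sum_linear S : linear (segment_sum S : c00 -> R^o).
Proof.
move=> a x y; have [r ur xr] := c00_support x.
have [s us ys] := c00_support y.
pose t := undup (r ++ s).
have xt phi : phi \notin t -> x phi = 0.
  by rewrite mem_undup mem_cat negb_or => /andP[/xr].
have yt phi : phi \notin t -> y phi = 0.
  by rewrite mem_undup mem_cat negb_or => /andP[_ /ys].
rewrite !(@segment_sumE t) ?undup_uniq//; last first.
  by move=> phi pt; rewrite -[LHS]/(a *: x phi + y phi) xt// yt// scaler0 addr0.
rewrite scaler_sumr -big_split/=; exact: eq_bigr.
Qed.

HB.instance Definition _ S := GRing.isLinear.Build R c00 R^o *:%R
  (segment_sum S) (segment_sum_linear S).

Lemma JH_sums_has_sup (x : c00) : has_sup (JH_sums x).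
Proof.
split.
  exists 0; exists 0%N, (fun=> set0); split; last by rewrite big_ord0.
  by split; [move=> []|exists 0%N, 0%N => -[]].
have [s us xs] := c00_support x; exists (\sum_(phi <- s) `|x phi|).
move=> _ [r [S [[tS _] ->]]].
under eq_bigr do rewrite (segment_sumE _ us xs).
apply: (@le_trans _ _ (\sum_(i < r) \sum_(phi <- s | phi \in S i) `|x phi|)).
  by apply: ler_sum => i _; exact: ler_norm_sum.
under eq_bigr do rewrite big_mkcond.
rewrite exchange_big/=; apply: ler_sum => phi _; rewrite -big_mkcond/=.
have [/existsP[i pi]|] := boolP [exists i : 'I_r, phi \in S i].
  rewrite (big_pred1 i)// => j; apply/idP/eqP => [pj|->//].
  by apply: (tS j i) => //; exists phi; split; rewrite -in_setE.
by move=> /existsPn nS; rewrite big_pred0// => i; exact/negbTE.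
Qed.

Lemma JH_norm_le (x : c00) M : (forall r (S : 'I_r -> set node),
  admissible S -> \sum_i `|segment_sum (S i) x| <= M) -> JH_norm x <= M.
Proof.
move=> xM; apply: ge_sup; first by case: (JH_sums_has_sup x).
by move=> _ [r [S [aS ->]]]; exact: xM.
Qed.

Lemma JH_norm_ge (x : c00) r (S : 'I_r -> set node) : admissible S ->
  \sum_i `|segment_sum (S i) x| <= JH_norm x.
Proof.
move=> aS; apply: sup_upper_bound; first exact: JH_sums_has_sup.
by exists r, S.
Qed.

Fact JH_normD x y : JH_norm (x + y) <= JH_norm x + JH_norm y.
Proof.
apply: JH_norm_le => r S aS.
rewrite (le_trans _ (lerD (JH_norm_ge x aS) (JH_norm_ge y aS)))//.
rewrite -big_split/=; apply: ler_sum => i _.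
by rewrite linearD; exact: ler_normD.
Qed.

Fact JH_normZ (a : R) x : JH_norm (a *: x) = `|a| * JH_norm x.
Proof.
have le b y : JH_norm (b *: y) <= `|b| * JH_norm y.
  apply: JH_norm_le => r S aS.
  rewrite (le_trans _ (ler_wpM2l _ (JH_norm_ge y aS)))// mulr_sumr.
  by apply: ler_sum => i _; rewrite linearZ/= normrM.
apply/eqP; rewrite eq_le le /=.
have [->|a0] := eqVneq a 0.
  rewrite normr0 mul0r (le_trans _ (@JH_norm_ge _ 0%N (fun=> set0) _))//.
    by rewrite big_ord0.
  by split; [move=> []|exists 0%N, 0%N => -[]].
rewrite -ler_pdivlMl ?normr_gt0// -normfV.
by apply: le_trans (le _ _); rewrite scalerA mulVf// scale1r.
Qed.

Fact JH_norm_eq0 x : JH_norm x = 0 -> x = 0.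
Proof.
move=> x0; apply/val_inj/funext => phi; apply/eqP; rewrite -normr_le0.
have aS : @admissible 1 (fun=> segment phi phi).
  split; first by move=> i j _ _ _; rewrite !ord1.
  by exists (size phi), (size phi) => _; exists phi, phi; rewrite prefix_refl.
have := JH_norm_ge x aS; rewrite x0 big_ord1.
rewrite (_ : segment phi phi = [set phi]) ?/segment_sum ?fsbig_set1//.
apply/seteqP; split=> [psi /= /andP[]|_ ->]; last by rewrite /segment/= prefix_refl.
by move=> /prefixP[s ->] /prefixP[t] /esym/eqP; rewrite -catA -[X in _ == X]cats0 eqseq_cat// eqxx/=; case: s => //; rewrite cats0.
Qed.

HB.instance Definition _ :=
  Lmodule_isNormed.Build R c00 JH_normD JH_normZ JH_norm_eq0.

End JamesHagler.

Definition JH (R : realType) : completeNormedModType R := completion (c00 R).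

Section JHCompletion.
Context (R : realType).

Lemma closure_normP (V : normedModType R) (A : set V) u :
  closure A u <-> forall e, 0 < e -> exists2 a, A a & `|u - a| < e.
Proof.
split=> [cu e e0|Au B /nbhs_ballP[e /= e0 eB]].
  have [|a [Aa]] := cu (ball u e); first exact: nbhsx_ballx.
  by rewrite -ball_normE/= => ua; exists a.
by have [a Aa ua] := Au _ e0; exists a; split=> //; apply: eB; rewrite -ball_normE.
Qed.

Lemma closure_linear (V : normedModType R) (A : set V) :
  linear_subspace A -> linear_subspace (closure A).
Proof.
move=> [A0 AD]; split; first exact: subset_closure.
move=> a u v /closure_normP Au /closure_normP Av; apply/closure_normP => e e0.
have a1 : 0 < `|a| + 1 by rewrite ltr_wpDl.
have [u' Au' uu'] := Au (e / 2 / (`|a| + 1)) ltac:(by rewrite !divr_gt0).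
have [v' Av' vv'] := Av (e / 2) ltac:(by rewrite divr_gt0).
exists (a *: u' + v'); first exact: AD.
rewrite opprD addrACA -scalerBr (splitr e) (le_lt_trans (ler_normD _ _))//.
rewrite ler_ltD// normrZ (le_trans (ler_wpM2l _ (ltW uu')))//.
by rewrite mulrCA ler_piMr ?divr_ge0 ?(ltW e0)// ler_pdivrMr// mul1r lerDl.
Qed.

Lemma to_completion_dense (X : normedModType R) :
  closure (range (@to_completion R X)) = setT.
Proof.
rewrite -subTset => z _; apply/closure_normP => e e0.
have L : linear_subspace (range (@bidual_eval R X)).
  split; first by exists 0 => //; apply/val_inj/funext => f; rewrite /= linear0.
  move=> a _ _ [x _ <-] [y _ <-]; exists (a *: x + y) => //.
  by apply/val_inj/funext => f; rewrite /= linearP.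
have : closure (range (@bidual_eval R X)) (val z).
  have := valP z; rewrite unfold_in inE; apply.
  split; last exact: subset_closure.
  by split; [exact: closed_closure|exact: closure_linear].
move=> /closure_normP/(_ _ e0)[_ [x _ <-] zx].
by exists (to_completion x) => //; exists x.
Qed.

Lemma JH_isometry (x : c00 R) : `|to_completion x| = `|x|.
Proof.
apply/eqP; rewrite eq_le; apply/andP; split.
  apply: opnorm_le => // f; rewrite [leRHS]mulrC; exact: (ler_opnorm f x).
apply: JH_norm_le => r S aS.
pose f (y : c00 R) : R^o := \sum_i Num.sg (segment_sum (S i) x) * segment_sum (S i) y.
have fle y : `|f y| <= 1 * `|y|.
  rewrite mul1r (le_trans (ler_norm_sum _ _ _))// (le_trans _ (JH_norm_ge y aS))//.
  by apply: ler_sum => i _; rewrite normrM ler_piMl// normr_sg; case: eqP.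
have bf : f \in @bounded_operator R (c00 R) R^o.
  apply/asboolP; split; last by exists 1.
  move=> a y z; rewrite /f scaler_sumr -big_split/=; apply: eq_bigr => i _.
  by rewrite linearP/= mulrDr scalerAr.
have -> : \sum_i `|segment_sum (S i) x| = bidual_eval x (Operator bf).
  by apply: eq_bigr => i _; exact: normrEsg.
rewrite (le_trans (ler_norm _))// (le_trans (ler_opnorm _ _))//.
by rewrite ler_piMr// ?opnorm_ge0//; exact: opnorm_le.
Qed.

End JHCompletion.

(* Main.v *)
Require Import Defs.
From mathcomp Require Import all_boot all_order all_algebra.
From mathcomp Require Import all_classical all_reals.
From HB Require Import structures.
From mathcomp Require Import topology normedtype sequences.
From mathcomp Require Import ring lra zify.

(** Write [e_phi] for the unit vectors of [JH] and put
    [u_(i,n) = e_(0^i 1 0^n 1)], [v_i^k = sum_(n < k) u_(i,n)].  For fixed [i]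
    the nodes [0^i 1 0^n 1] hang off the single branch [0^i 1 0 0 0 ...], and
    the [u_(i,n)] satisfy an upper [c_0] estimate ([leaf_sum_norm]); in
    particular [norm v_i^k <= 2].

    Let [a] be a real [M x M] matrix whose bilinear form has norm at most 1 on
    [l_infty x l_infty], and let
    [T_k = sum_(i,j < M) a_ij v_i^k (x) v_j^k].  Then [norm T_k <= 4]
    ([norm_block]) and [T_k] is weakly Cauchy ([block_cauchy]).  The sequence
    violating property (u) is [sum_(r < k) 2^-r T_k^(r)], with blocks [T_k^(r)]
    built in this way over disjoint sets of indices [i], and with matrices
    [a^(r)] chosen as follows.

    The triangle projection is unbounded for the norm of bilinear forms on
    [l_infty x l_infty]: there are matrices of norm at most 1 for which
    [sum_(j < i) a_ij] is as large as desired ([triangle_unbounded]).  An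
    explicit example is the dyadic antisymmetric matrix
    [A_(n+1) = ((A_n, -J/2^n), (J/2^n, A_n))], where [J] is the all-ones matrix.
    Its lower triangle sums to [n 2^n / 2], whereas expanding the off-diagonal
    blocks in Haar functions and using the Bessel inequality bounds its norm by
    a constant times [2^n sqrt n].

    Suppose now that [sum y_n] is weakly unconditionally Cauchy with constant
    [K] and that its partial sums differ from the sequence by a weakly null
    sequence, and fix a block [r].  For
    [nu : nat -> option nat] the functional [F_nu] ([branch_functional]) adds
    up, from a common level [p] on, the values of [x] along the branches
    [0^i 1 0^(nu_i) 1 0 0 0 ...], or [0^i 1 0 0 0 ...] if [nu_i] is [None].
    These branches are disjoint from level [p] on, so [F_nu] has norm at most
    1.  Moreover, for [i] in the block, [F_nu (v_i^k)] is 1 if [nu_i < k] and 0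
    otherwise (if all [nu_i] are at least [p]), and
    [F_nu] converges weak* to [F_nu'] when one coordinate of [nu] goes to
    infinity and is [None] in [nu'].  Finite-rank weak*-weakly continuous
    operators, hence all elements [T] of the tensor product, satisfy
    [g (T f_n) -> g (T f)] along weak* convergent bounded sequences
    ([pairing_cvgl]).

    Start with pairs [(f, g) = (F_nu, F_mu)] with all coordinates [None] and
    switch on, in turn, [nu_0, mu_0, nu_1, mu_1, ...], each time waiting long
    enough so that the partial sums of [sum y_n] selected so far are barely
    affected, and then selecting a new partial sum close to the limit
    ([adaptive_selection]).  After [l] steps, the limit of the sequence tested
    against [(f, g)] is [2^-r sum a_ij] over the rows and columns switched on so
    far.  The final pair [(f, g)] sees all these values along one sequence of
    partial sums, so that their total variation is at most [K].  Switching on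
    row [i] changes the value by [2^-r sum_(j < i) a_ij], so that
    [2^-r sum_(j < i < M) a_ij <= K] for all [r] ([block_variation]), which is
    absurd for a suitable choice of the matrices. *)

Set Implicit Arguments.
Unset Strict Implicit.
Unset Printing Implicit Defensive.

Import Order.TTheory GRing.Theory Num.Theory.
Import numFieldNormedType.Exports.

Local Open Scope classical_set_scope.
Local Open Scope ring_scope.

(** * The triangle projection is unbounded *)

Section DyadicMatrix.
Context (R : realType).
Implicit Types (s t : nat -> R).

(** Entries of the antisymmetric dyadic matrix of size [2 ^ n]: zero diagonal
    and, if [i] and [j] lie in different halves of a dyadic interval of length
    [2 ^ m.+1], the entry is [1 / 2 ^ m] below the diagonal and [- 1 / 2 ^ m]
    above it. *)
Fixpoint dyadic_mx (n i j : nat) : R :=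
  if n is m.+1 then
    if (i < 2 ^ m)%N then
      if (j < 2 ^ m)%N then dyadic_mx m i j else - (2 ^+ m)^-1
    else
      if (j < 2 ^ m)%N then (2 ^+ m)^-1
      else dyadic_mx m (i - 2 ^ m) (j - 2 ^ m)
  else 0.

(** The sum, over the dyadic subintervals of [{0, ..., 2 ^ n - 1}] of length at
    least 2, of the absolute values of the unnormalized Haar coefficients of [s]. *)
Fixpoint haar_sum (n : nat) s : R :=
  if n is m.+1 then
    haar_sum m s + haar_sum m (fun i => s (2 ^ m + i)%N) +
    `|\sum_(i < 2 ^ m) s i - \sum_(i < 2 ^ m) s (2 ^ m + i)%N|
  else 0.

Lemma sum_halves n (F : nat -> R) :
  \sum_(i < 2 ^ n.+1) F i = \sum_(i < 2 ^ n) F i + \sum_(i < 2 ^ n) F (2 ^ n + i)%N.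
Proof. by rewrite expnS mul2n -addnn big_split_ord. Qed.

Lemma dyadic_mxS n s t :
  \sum_(i < 2 ^ n.+1) \sum_(j < 2 ^ n.+1) dyadic_mx n.+1 i j * s i * t j =
  \sum_(i < 2 ^ n) \sum_(j < 2 ^ n) dyadic_mx n i j * s i * t j +
  \sum_(i < 2 ^ n) \sum_(j < 2 ^ n)
    dyadic_mx n i j * s (2 ^ n + i)%N * t (2 ^ n + j)%N +
  (2 ^+ n)^-1 * ((\sum_(i < 2 ^ n) s (2 ^ n + i)%N) * (\sum_(j < 2 ^ n) t j) -
    (\sum_(i < 2 ^ n) s i) * \sum_(j < 2 ^ n) t (2 ^ n + j)%N).
Proof.
have lt (i : 'I_(2 ^ n)) : (i < 2 ^ n)%N by exact: ltn_ord.
have ge i : (2 ^ n + i < 2 ^ n)%N = false by rewrite ltnNge leq_addr.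
rewrite (sum_halves n (fun i => \sum_(j < 2 ^ n.+1) dyadic_mx n.+1 i j * s i * t j)).
set p := (2 ^+ n)^-1; rewrite mulrBr.
have -> : \sum_(i < 2 ^ n) \sum_(j < 2 ^ n.+1) dyadic_mx n.+1 i j * s i * t j =
    \sum_(i < 2 ^ n) \sum_(j < 2 ^ n) dyadic_mx n i j * s i * t j -
    p * ((\sum_(i < 2 ^ n) s i) * \sum_(j < 2 ^ n) t (2 ^ n + j)%N).
  rewrite mulr_suml mulr_sumr -sumrB; apply: eq_bigr => i _.
  rewrite (sum_halves n (fun j => dyadic_mx n.+1 i j * s i * t j)).
  rewrite !mulr_sumr -sumrN/=; congr (_ + _); apply: eq_bigr => j _.
    by rewrite !lt.
  by rewrite lt ge !mulNr mulrA.
have -> : \sum_(i < 2 ^ n) \sum_(j < 2 ^ n.+1)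
      dyadic_mx n.+1 (2 ^ n + i) j * s (2 ^ n + i)%N * t j =
    p * ((\sum_(i < 2 ^ n) s (2 ^ n + i)%N) * \sum_(j < 2 ^ n) t j) +
    \sum_(i < 2 ^ n) \sum_(j < 2 ^ n)
      dyadic_mx n i j * s (2 ^ n + i)%N * t (2 ^ n + j)%N.
  rewrite mulr_suml mulr_sumr -big_split; apply: eq_bigr => i _.
  rewrite (sum_halves n (fun j => dyadic_mx n.+1 (2 ^ n + i) j * _ * t j)).
  rewrite !mulr_sumr/=; congr (_ + _); apply: eq_bigr => j _.
    by rewrite lt ge mulrA.
  by rewrite !ge !addKn.
ring.
Qed.

Lemma sum_bounded n s : (forall i, `|s i| <= 1) -> `|\sum_(i < n) s i| <= n%:R.
Proof.
move=> s1; rewrite (le_trans (ler_norm_sum _ _ _))//.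
apply: le_trans (_ : \sum_(i < n) (1 : R) <= _); first exact: ler_sum.
by rewrite sumr_const card_ord.
Qed.

(** On each dyadic interval the off-diagonal blocks contribute
    [(b c - a d) / N], with [a, b] (resp. [c, d]) the sums of [s] (resp. [t])
    over the two halves, and
    [2 (b c - a d) = (a + b) (c - d) - (a - b) (c + d)]. *)
Lemma dyadic_mx_haar n s t : (forall i, `|s i| <= 1) -> (forall i, `|t i| <= 1) ->
  `|\sum_(i < 2 ^ n) \sum_(j < 2 ^ n) dyadic_mx n i j * s i * t j| <=
  haar_sum n s + haar_sum n t.
Proof.
elim: n s t => [|n IH] s t s1 t1.
  by rewrite !big_ord1 !mul0r normr0 addr0.
rewrite dyadic_mxS/=.
have B1 := IH _ _ s1 t1.
have B2 := IH (fun i => s (2 ^ n + i)%N) (fun i => t (2 ^ n + i)%N)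
  (fun i => s1 _) (fun i => t1 _).
have H1 := sum_bounded (2 ^ n) s1; have H2 := sum_bounded (2 ^ n) t1.
have H3 := sum_bounded (2 ^ n) (fun i => s1 (2 ^ n + i)%N).
have H4 := sum_bounded (2 ^ n) (fun i => t1 (2 ^ n + i)%N).
rewrite natrX in H1 H2 H3 H4.
move: B1 B2 H1 H2 H3 H4.
set A := \sum_(i < _) \sum_(j < _) _; set A' := \sum_(i < _) \sum_(j < _) _.
set a := \sum_(i < _) s i; set b := \sum_(i < _) s _.
set c := \sum_(i < _) t i; set d := \sum_(i < _) t _.
set h1 := haar_sum _ _; set h2 := haar_sum _ _.
set h3 := haar_sum _ _; set h4 := haar_sum _ _.
move=> B1 B2 H1 H2 H3 H4.
have N0 : 0 < 2 ^+ n :> R by rewrite exprn_gt0.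
have : `|(2 ^+ n)^-1 * (b * c - a * d)| <= `|a - b| + `|c - d|.
  rewrite normrM normfV (gtr0_norm N0) ler_pdivrMl//.
  have -> : b * c - a * d = 2^-1 * ((a + b) * (c - d) - (a - b) * (c + d)) by field.
  rewrite normrM gtr0_norm ?invr_gt0// ler_pdivrMl//.
  rewrite (le_trans (ler_normB _ _))// !normrM.
  rewrite mulrA mulrDr addrC; apply: lerD.
    rewrite mulrC ler_wpM2r// (le_trans (ler_normD _ _))//; lra.
  rewrite ler_wpM2r// (le_trans (ler_normD _ _))//; lra.
move=> H5; rewrite (le_trans (ler_normD _ _))//.
have := ler_normD A A'; lra.
Qed.

(** Bessel's inequality, combined with the inequality
    [x <= l N + x ^ 2 / (4 l N)] for each Haar coefficient; the term
    [(sum s) ^ 2] makes the induction go through with equality. *)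
Lemma haar_sum_le n s (l : R) : 0 < l ->
  haar_sum n s <= l * n%:R * 2 ^+ n / 2 +
    (2 * l)^-1 * (\sum_(i < 2 ^ n) s i ^+ 2 - (\sum_(i < 2 ^ n) s i) ^+ 2 / 2 ^+ n).
Proof.
move=> l0; elim: n s => [|n IH] s.
  by rewrite !big_ord1 expr0 divr1 subrr !mulr0 mul0r mul0r addr0.
rewrite /= (sum_halves n s) (sum_halves n (fun i => s i ^+ 2)).
have := IH s; have := IH (fun i => s (2 ^ n + i)%N).
set a := \sum_(i < _) s i; set b := \sum_(i < _) s _.
set c := \sum_(i < _) s i ^+ 2; set d := \sum_(i < _) s _ ^+ 2.
set h1 := haar_sum _ _; set h2 := haar_sum _ _ => B1 B2.
have N0 : 0 < 2 ^+ n :> R by rewrite exprn_gt0.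
set N := 2 ^+ n in N0 B1 B2 *.
have H : `|a - b| <= l * N + (a - b) ^+ 2 / (4 * l * N).
  rewrite -[(a - b) ^+ 2]real_normK ?num_real//; set x := `|a - b|.
  have lN : 0 < 4 * l * N by rewrite !mulr_gt0.
  rewrite -subr_ge0.
  have -> : l * N + x ^+ 2 / (4 * l * N) - x = (x - 2 * l * N) ^+ 2 / (4 * l * N).
    by field; rewrite (gt_eqF l0) (gt_eqF N0).
  by rewrite divr_ge0 ?sqr_ge0 ?ltW.
rewrite (le_trans (lerD (lerD B2 B1) H))// le_eqVlt; apply/orP; left; apply/eqP.
rewrite (exprS _ n) -/N (mulrSr _ n); field.
by rewrite (gt_eqF l0) (gt_eqF N0).
Qed.

Lemma dyadic_mx_lower n :
  \sum_(i < 2 ^ n) \sum_(j < i) dyadic_mx n i j = n%:R * 2 ^+ n / 2.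
Proof.
elim: n => [|n IH]; first by rewrite big_ord1 big_ord0 !mul0r.
have ge i : (2 ^ n + i < 2 ^ n)%N = false by rewrite ltnNge leq_addr.
rewrite (sum_halves n (fun i => \sum_(j < i) dyadic_mx n.+1 i j)).
have -> : \sum_(i < 2 ^ n) \sum_(j < i) dyadic_mx n.+1 i j =
    \sum_(i < 2 ^ n) \sum_(j < i) dyadic_mx n i j.
  apply: eq_bigr => i _; apply: eq_bigr => j _ /=.
  by rewrite ltn_ord (ltn_trans (ltn_ord j)).
have -> : \sum_(i < 2 ^ n) \sum_(j < 2 ^ n + i) dyadic_mx n.+1 (2 ^ n + i) j =
    \sum_(i < 2 ^ n) (1 + \sum_(j < i) dyadic_mx n i j).
  apply: eq_bigr => i _; rewrite big_split_ord/=; congr (_ + _).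
    under eq_bigr => j _ do rewrite ge ltn_ord.
    by rewrite sumr_const card_ord -[_ *+ _]mulr_natr natrX mulVf ?expf_neq0 ?pnatr_eq0.
  apply: eq_bigr => j _.
  by rewrite !ge !addKn.
rewrite big_split/= sumr_const card_ord IH natrX exprS mulrSr; by field.
Qed.

(** Unboundedness of the main triangle projection, for the norm of bilinear
    forms on [l_infty x l_infty]. *)
Lemma triangle_unbounded (m : nat) : (0 < m)%N ->
  exists M (a : nat -> nat -> R),
  [/\ forall s t : nat -> R, (forall i, `|s i| <= 1) -> (forall j, `|t j| <= 1) ->
        `|\sum_(i < M) \sum_(j < M) a i j * s i * t j| <= 1 &
      m%:R <= \sum_(i < M) \sum_(j < i) a i j].
Proof.
move=> m0.
(* For size 2 ^ (k ^ 2) and l = 1 / k the norm is at most k 2 ^ (k ^ 2 + 1),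
   which gives the normalization z below. *)
pose k := (4 * m)%N.
have k0 : 0 < k%:R :> R by rewrite ltr0n muln_gt0.
have N0 : 0 < 2 ^+ (k ^ 2) :> R by rewrite exprn_gt0.
pose z : R := 2 * 2 ^+ (k ^ 2) * k%:R.
have z0 : 0 < z by rewrite !mulr_gt0.
exists (2 ^ (k ^ 2))%N, (fun i j => z^-1 * dyadic_mx (k ^ 2) i j); split.
  move=> s t s1 t1.
  under eq_bigr => i _ do under eq_bigr => j _ do rewrite -!mulrA.
  under eq_bigr => i _ do rewrite -mulr_sumr.
  rewrite -mulr_sumr normrM gtr0_norm ?invr_gt0// ler_pdivrMl// mulr1.
  under eq_bigr => i _ do under eq_bigr => j _ do rewrite mulrA.
  rewrite (le_trans (dyadic_mx_haar _ s1 t1))//.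
  have H u : (forall i, `|u i| <= 1) -> haar_sum (k ^ 2) u <= z / 2.
    move=> u1; rewrite (le_trans (haar_sum_le _ _ (_ : 0 < k%:R^-1)))// ?invr_gt0//.
    have U : \sum_(i < 2 ^ k ^ 2) u i ^+ 2 <= 2 ^+ (k ^ 2).
      apply: le_trans (_ : \sum_(i < 2 ^ k ^ 2) (1 : R) <= _).
        apply: ler_sum => i _; rewrite -[_ ^+ 2]real_normK ?num_real//.
        by rewrite exprn_ile1.
      by rewrite sumr_const card_ord natrX.
    have : (2 / k%:R)^-1 * (\sum_(i < 2 ^ k ^ 2) u i ^+ 2 -
       (\sum_(i < 2 ^ k ^ 2) u i) ^+ 2 / 2 ^+ (k ^ 2)) <= (2 / k%:R)^-1 * 2 ^+ (k ^ 2).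
      rewrite ler_wpM2l ?invr_ge0 ?divr_ge0//.
      rewrite (le_trans _ U)// lerBlDr lerDl divr_ge0 ?sqr_ge0//.
      exact: ltW.
    rewrite natrX /z => B.
    rewrite (le_trans (lerD (lexx _) B))// le_eqVlt; apply/orP; left; apply/eqP.
    by field; rewrite (gt_eqF k0).
  by rewrite (le_trans (lerD (H _ s1) (H _ t1)))// -splitr.
under eq_bigr => i _ do rewrite -mulr_sumr.
rewrite -mulr_sumr dyadic_mx_lower natrX le_eqVlt; apply/orP; left; apply/eqP.
have m0' : m%:R != 0 :> R by rewrite pnatr_eq0 -lt0n.
rewrite /z /k natrM; field.
by rewrite m0' (gt_eqF N0).
Qed.

End DyadicMatrix.

(** * Nodes hanging off a branch, and upper [c_0] estimates in [JH] *)

Lemma take_mkseq (T : Type) (f : nat -> T) p q : (p <= q)%N ->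
  take p (mkseq f q) = mkseq f p.
Proof.
by move=> pq; rewrite /mkseq -map_take take_iota (minn_idPl pq).
Qed.

Lemma prefix_mkseq (f : nat -> bool) p q : (p <= q)%N ->
  prefix (mkseq f p) (mkseq f q).
Proof. by move=> pq; rewrite prefixE size_mkseq take_mkseq. Qed.

Lemma prefix_mkseqP (psi : node) (f : nat -> bool) q : prefix psi (mkseq f q) ->
  (size psi <= q)%N /\ psi = mkseq f (size psi).
Proof.
move=> H; have := size_prefix H; rewrite size_mkseq => s; split=> //.
by move: H; rewrite prefixE take_mkseq// => /eqP.
Qed.

Section Nodes.

(** The infinite branch [0^i 1 0^n 1 0 0 0 ...] if [o = Some n], and
    [0^i 1 0 0 0 ...] if [o = None], as a sequence of bits. *)
Definition path_bit (i : nat) (o : option nat) (j : nat) : bool :=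
  (j == i) || (if o is Some n then j == (i + n).+1 else false).

(** The node [0^i 1 0^n 1]. *)
Definition leaf (i n : nat) : node := mkseq (path_bit i (Some n)) (i + n).+2.

Lemma size_leaf i n : size (leaf i n) = (i + n).+2.
Proof. exact: size_mkseq. Qed.

(** The nodes of length at least [p] on the branch [path_bit i o]. *)
Definition path_tail (p i : nat) (o : option nat) : set node :=
  [set phi : node | (p <= size phi)%N /\ phi = mkseq (path_bit i o) (size phi)].

(** From level [p] on, the only node [0^i' 1 0^n 1] on the branch of
    [0^i 1 0^m 1] is [0^i 1 0^m 1] itself, and the branch [0^i 1 0 0 0 ...]
    has none. *)
Lemma leaf_path_tail p i o i' n : (if o is Some m then p <= (i + m).+2 else true)%N ->
  (leaf i' n \in path_tail p i o) = (i' == i) && (Some n == o).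
Proof.
move=> po; apply/idP/idP; last first.
  move=> /andP[/eqP -> /eqP oE]; rewrite -oE in po *; apply/mem_set.
  by split; rewrite size_leaf.
move=> /set_mem[]; rewrite size_leaf => pi E; have nthE j : (j < (i' + n).+2)%N ->
    path_bit i' (Some n) j = path_bit i o j.
  by move=> jn; have := congr1 (fun s => nth false s j) E; rewrite !nth_mkseq.
have := nthE i' ltac:(lia); have := nthE (i' + n).+1 ltac:(lia).
rewrite /path_bit !eqxx/= orbT.
case: o po nthE {E} => [m|] po nthE.
  move=> /esym/orP[] /eqP A /esym/orP[] /eqP B; try lia.
  by rewrite B eqxx/=; apply/eqP; congr Some; lia.
by rewrite !orbF => /esym/eqP A /esym/eqP B; lia.
Qed.

Lemma prefix_take (s1 s2 s : node) : prefix s1 s -> prefix s2 s ->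
  (size s1 <= size s2)%N -> s1 = take (size s1) s2.
Proof.
by rewrite !prefixE => /eqP E1 /eqP E2 le; rewrite -E2 take_takel// E1.
Qed.

Lemma leaf_prefix_inj i n m (psi : node) :
  prefix (leaf i n) psi -> prefix (leaf i m) psi -> n = m.
Proof.
wlog nm : n m / (n <= m)%N.
  by move=> H A B; case/orP: (leq_total n m) => nm; [exact: H|symmetry; exact: H].
move=> A B.
have : leaf i n = take (size (leaf i n)) (leaf i m).
  by apply: prefix_take A B _; rewrite !size_leaf; lia.
rewrite size_leaf take_mkseq; last by lia.
move=> /(congr1 (fun s => nth false s (i + n).+1)).
rewrite !nth_mkseq ?ltnSn// /path_bit eqxx orbT => /esym/orP[]/eqP; lia.
Qed.

(** Proper prefixes of [leaf i n] do not depend on [n], apart from their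
    length. *)
Lemma prefix_leaf_trunk (phi : node) i n : prefix phi (leaf i n) ->
  (size phi < (i + n).+2)%N -> phi = mkseq (path_bit i None) (size phi).
Proof.
move=> /prefix_mkseqP[_ phiE] s; rewrite [LHS]phiE.
apply/eq_in_map => j; rewrite mem_iota /path_bit => js.
suff -> : (j == (i + n).+1) = false by [].
by apply/eqP; lia.
Qed.

Lemma segment_start (phi psi : node) : prefix phi psi -> segment phi psi phi.
Proof. by move=> pp; rewrite /segment/= prefix_refl. Qed.

Lemma path_tail_segment p i o q : (p <= q)%N ->
  path_tail p i o `&` [set phi : node | (size phi <= q)%N] =
  segment (mkseq (path_bit i o) p) (mkseq (path_bit i o) q).
Proof.
move=> pq; apply/seteqP; split=> phi.
  move=> [[ps ->]]; rewrite /= size_mkseq => sq.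
  by rewrite /segment/= !prefix_mkseq.
move=> /andP[A /prefix_mkseqP[sq phiE]]; split=> //; split=> //.
by have := size_prefix A; rewrite size_mkseq.
Qed.

End Nodes.

Section UnitVectors.
Context (R : realType).

Fact unit_vector_subproof (phi : node) :
  (fun psi : node => (psi == phi)%:R : R) \in @finitely_supported R.
Proof.
apply/asboolP; apply: (@sub_finite_set _ _ [set phi]) => // psi /=.
by have [->//|_] := eqVneq psi phi; rewrite eqxx.
Qed.

(** The indicator function of a node, as an element of [c00]. *)
Definition unit_vector (phi : node) : c00 R := C00 (unit_vector_subproof phi).

Lemma segment_sum_unit_vector S phi :
  segment_sum S (unit_vector phi) = (phi \in S)%:R.
Proof.
rewrite (@segment_sumE _ [:: phi])//; last first.
  by move=> psi; rewrite inE /= => /negbTE ->.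
by rewrite big_mkcond big_seq1/= eqxx; case: ifP.
Qed.

Lemma sum_unique (T : finType) (P : pred T) :
  (forall x y, P x -> P y -> x = y) -> \sum_x (P x)%:R <= 1 :> R.
Proof.
move=> PU; case: (pickP P) => [x Px|P0]; last first.
  by rewrite big1// => x _; rewrite P0.
rewrite (bigD1 x)//= big1 ?Px ?addr0// => y yx.
by case: (boolP (P y)) => // Py; rewrite (PU _ _ Px Py) eqxx in yx.
Qed.

(** For fixed [i] the unit vectors at the nodes [leaf i n] satisfy an upper
    [c_0] estimate in [JH].  In an admissible family of segments starting at
    level [p], a segment contains at most one of these nodes; if this node is
    not at level [p] then the segment starts on the branch
    [0^i 1 0 0 0 ...], and at most one segment of the family does.  As at most
    one of these nodes is at level [p], at most two segments of the family
    meet them. *)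
Lemma leaf_sum_norm i N (c : nat -> R) (C : R) : 0 <= C ->
  (forall n, `|c n| <= C) ->
  `|\sum_(n < N) c n *: unit_vector (leaf i n)| <= 2 * C.
Proof.
move=> C0 cC; apply: JH_norm_le => r S [tS [p [q hS]]].
have Sinj l l' phi : phi \in S l -> phi \in S l' -> l = l'.
  by rewrite !inE => A B; apply: tS => //; exists phi.
(* P1: the node is the starting point of its segment; P2: it is not. *)
pose P1 (x : 'I_r * 'I_N) := (leaf i x.2 \in S x.1) && ((i + x.2).+2 == p).
pose P2 (x : 'I_r * 'I_N) := (leaf i x.2 \in S x.1) && ((i + x.2).+2 != p).
have U1 : \sum_x (P1 x)%:R <= 1 :> R.
  apply: sum_unique => -[l n] [l' n'] /andP[/= A /eqP sn] /andP[/= B /eqP sn'].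
  have nn' : n = n' by apply/val_inj; move: sn sn' => /=; lia.
  by rewrite nn' in A *; rewrite (Sinj _ _ _ A B).
have U2 : \sum_x (P2 x)%:R <= 1 :> R.
  apply: sum_unique => -[l n] [l' n'] /andP[/= A sn] /andP[/= B sn'].
  have [phi [psi [pp sphi spsi SE]]] := hS l.
  have [phi' [psi' [pp' sphi' spsi' SE']]] := hS l'.
  move: (A) (B); rewrite !inE SE SE' => /andP[phin npsi] /andP[phin' npsi'].
  have lt : (size phi < (i + n).+2)%N.
    rewrite ltn_neqAle sphi eq_sym sn.
    by rewrite -sphi -size_leaf size_prefix.
  have lt' : (size phi' < (i + n').+2)%N.
    rewrite ltn_neqAle sphi' eq_sym sn'.
    by rewrite -sphi' -size_leaf size_prefix.
  have phiE : phi = phi'.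
    by rewrite (prefix_leaf_trunk phin lt) (prefix_leaf_trunk phin' lt') sphi sphi'.
  have ll' : l = l'.
    apply: (Sinj _ _ phi); rewrite inE ?SE ?SE' ?phiE; apply: segment_start => //.
    by rewrite -phiE.
  rewrite -ll' in B *; move: B; rewrite inE SE => /andP[_ n'psi].
  by congr (_, _); apply/val_inj; exact: leaf_prefix_inj npsi n'psi.
have B l : `|segment_sum (S l) (\sum_(n < N) c n *: unit_vector (leaf i n))| <=
    C * \sum_(n < N) (leaf i n \in S l)%:R.
  rewrite linear_sum mulr_sumr (le_trans (ler_norm_sum _ _ _))//.
  apply: ler_sum => n _; rewrite linearZ/= segment_sum_unit_vector normrM.
  by rewrite (ger0_norm (ler0n _ _)) ler_wpM2r.
rewrite (le_trans (ler_sum _ (fun l _ => B l)))// -mulr_sumr mulrC ler_wpM2r//.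
rewrite pair_big/= (le_trans _ (lerD U1 U2))// -big_split/=.
apply: ler_sum => -[l n] _; rewrite /P1 /P2/=.
by case: (_ \in _); case: eqP => _; rewrite /= ?addr0 ?add0r.
Qed.

End UnitVectors.

(** * Functionals on completions and on injective tensor products *)

(** The vectors at which a bounded sequence of functionals converges to a given
    functional form a closed linear subspace. *)
Section PointwiseLimits.
Context (R : realType) (V : normedModType R).
Variables (h : nat -> V -> R^o) (h0 : V -> R^o) (C : R).
Hypotheses (hl : forall n, linear (h n)) (h0l : linear h0).
Hypotheses (hC : forall n v, `|h n v| <= C * `|v|) (h0C : forall v, `|h0 v| <= C * `|v|).

Lemma pointwise_cvg_subspace :
  linear_subspace [set v | (fun n => h n v) @ \oo --> h0 v].
Proof.
have lin0 (k : V -> R^o) : linear k -> k 0 = 0.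
  by move=> kl; have := kl (-1) 0 0; rewrite scaler0 addr0 scaleN1r addNr.
split=> [|a u v] /=.
  rewrite (lin0 h0)// (_ : (fun n => _) = fun=> 0); first exact: cvg_cst.
  by apply/funext => n; exact: lin0 (hl n).
move=> hu hv; rewrite h0l (_ : (fun n => h n _) = fun n => a *: h n u + h n v).
  by apply: cvgD => //; exact: cvgZl_tmp.
by apply/funext => n; exact: hl.
Qed.

Lemma pointwise_cvg_closed : closed [set v | (fun n => h n v) @ \oo --> h0 v].
Proof.
have linB (k : V -> R^o) u v : linear k -> k (u - v) = k u - k v.
  by move=> kl; rewrite (addrC u) -scaleN1r kl scaleN1r addrC.
move=> v /closure_normP cv; apply/cvgrPdist_le => e e0.
have C0 : 0 <= `|C| by [].
have C1 : 0 < `|C| + 1 by rewrite ltr_wpDl.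
have [w /= /cvgrPdist_le hw vw] := cv (e / 3 / (`|C| + 1)) ltac:(by rewrite !divr_gt0).
have small (k : V -> R^o) : linear k -> (forall v, `|k v| <= C * `|v|) ->
    `|k v - k w| <= e / 3.
  move=> kl kC; rewrite -linB// (le_trans (kC _))//.
  rewrite (@le_trans _ _ ((`|C| + 1) * (e / 3 / (`|C| + 1))))//; last first.
    by rewrite mulrC divfK// gt_eqF.
  apply: le_trans (_ : (`|C| + 1) * `|v - w| <= _).
    by rewrite ler_wpM2r// (le_trans (ler_norm C))// lerDl.
  by rewrite ler_wpM2l// ltW.
have e3 : 0 < e / 3 by rewrite divr_gt0.
apply: filterS (hw _ e3) => n hn.
have -> : h0 v - h n v = (h0 v - h0 w) + (h0 w - h n w) - (h n v - h n w).
  by rewrite addrA subrK opprB addrA subrK.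
have := small _ h0l h0C; have := small _ (hl n) (hC n) => S1 S2.
rewrite (le_trans (ler_normB _ _))//.
have := ler_normD (h0 v - h0 w) (h0 w - h n w); lra.
Qed.

End PointwiseLimits.

Section Pairing.
Context (R : realType).

Lemma operatorPE (E F : normedModType R) (a : R) (f g : operator E F) x :
  (a *: f + g) x = a *: f x + g x.
Proof. by []. Qed.

Lemma closed_span_valP (V : normedModType R) (A : set V) (a : R)
    (u v : closed_span_of A) : val (a *: u + v) = a *: val u + val v.
Proof. by rewrite linearP. Qed.

Lemma closed_span_normE (V : normedModType R) (A : set V)
    (u : closed_span_of A) : `|u| = `|val u|.
Proof. by []. Qed.

Section Extend.
Context (X : normedModType R).

Fact extend_subproof (phi : dual X) :
  (fun z : completion X => val z phi : R^o) \in @bounded_operator R (completion X) R^o.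
Proof.
apply/asboolP; split.
  by move=> a u v; rewrite closed_span_valP operatorPE.
exists `|phi| => z.
by rewrite mulrC; exact: (ler_opnorm (val z) phi).
Qed.

(** The functional on the completion of [X] induced by a functional on [X]:
    the completion is a subspace of the bidual, so that this is evaluation at
    [phi]. *)
Definition extend (phi : dual X) : dual (completion X) :=
  Operator (extend_subproof phi).

Lemma extendE (phi : dual X) x : extend phi (to_completion x) = phi x.
Proof. by []. Qed.

Lemma norm_extend (phi : dual X) : `|extend phi| <= `|phi|.
Proof.
by apply: opnorm_le => // z; rewrite mulrC; exact: (ler_opnorm (val z) phi).
Qed.

Lemma extend_cvg (phi : nat -> dual X) (phi0 : dual X) (C : R) :
  (forall n, `|phi n| <= C) -> `|phi0| <= C ->
  (forall x, (fun n => phi n x) @ \oo --> phi0 x) ->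
  forall z, (fun n => extend (phi n) z) @ \oo --> extend phi0 z.
Proof.
move=> phiC phi0C phix z.
have bnd (u : dual (dual X)) (f : dual X) : `|f| <= C -> `|u f| <= C * `|u|.
  move=> fC; rewrite (le_trans (ler_opnorm u f))// mulrC.
  by rewrite ler_wpM2r ?opnorm_ge0.
pose W := [set u : dual (dual X) | (fun n => u (phi n)) @ \oo --> u phi0].
suff : closed_span (range (@bidual_eval R X)) `<=` W.
  by apply; have := valP z; rewrite unfold_in inE.
apply: smallest_sub; last by move=> _ [x _ <-]; exact: phix.
split.
  apply: (@pointwise_cvg_closed _ _ (fun n (u : dual (dual X)) => u (phi n))
    (fun u : dual (dual X) => u phi0) C).
  - by move=> n a u v; rewrite operatorPE.
  - by move=> a u v; rewrite operatorPE.
  - by move=> n u; exact: bnd.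
  - by move=> u; exact: bnd.
apply: (@pointwise_cvg_subspace _ _ (fun n (u : dual (dual X)) => u (phi n))
  (fun u : dual (dual X) => u phi0)).
- by move=> n a u v; rewrite operatorPE.
- by move=> a u v; rewrite operatorPE.
Qed.

End Extend.

Section Tensor.
Context (E F : completeNormedModType R).
Implicit Types (f : dual E) (g : dual F) (z : E) (w : F).

Fact rank1_subproof z w :
  (fun f : dual E => f z *: w) \in @bounded_operator R (dual E) F.
Proof.
apply/asboolP; split=> [a f g|].
  by rewrite operatorPE scalerDl scalerA.
exists (`|z| * `|w|) => f; rewrite normrZ mulrAC ler_wpM2r// mulrC.
exact: ler_opnorm.
Qed.

(** The rank-one operator [f |-> f z *: w]. *)
Definition rank1_op z w : operator (dual E) F := Operator (rank1_subproof z w).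

Fact rank1_tensor z w : rank1_op z w \in in_closed_span
  [set T : operator (dual E) F | finite_rank T /\ weak_star_weak_continuous T].
Proof.
rewrite unfold_in inE; apply: sub_gen_smallest; split.
  by exists 1%N, (fun=> w) => f; exists (fun=> f z); rewrite big_ord1.
move=> f.
have Ff : Filter (nbhs (f : weak_star E)) by exact: nbhs_filter.
apply/weak_cvgP.
move=> g; have fz : (fun f' : dual E => f' z : R^o) @ nbhs (f : weak_star E) --> f z.
  have : nbhs (f : weak_star E) --> (f : weak_star E) by [].
  by move=> /initial_cvgP/cvg_sup/(_ z)/initial_cvgP.
have gE f' : g (rank1_op z w f') = f' z *: g w by rewrite /= linearZ.
rewrite gE -[X in X --> _]/((fun f' : dual E => g (rank1_op z w f')) @ nbhs (f : weak_star E)).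
rewrite (_ : (fun f' : dual E => g _) = fun f' : dual E => f' z *: g w).
  exact: cvgZr_tmp.
exact/funext.
Qed.

(** The elementary tensor of [z] and [w]. *)
Definition tensor z w : injective_tensor E F := ClosedSpan (rank1_tensor z w).

Lemma tensorE z w f : val (tensor z w) f = f z *: w. Proof. by []. Qed.

Fact pairing_subproof f g : (fun T : injective_tensor E F => g (val T f) : R^o)
  \in @bounded_operator R (injective_tensor E F) R^o.
Proof.
apply/asboolP; split.
  by move=> a S T; rewrite closed_span_valP operatorPE linearP.
exists (`|g| * `|f|) => T; rewrite (le_trans (ler_opnorm _ _))// -mulrA.
rewrite ler_wpM2l ?opnorm_ge0// mulrC; exact: (ler_opnorm (val T) f).
Qed.

(** The functional [T |-> g (T f)] on the injective tensor product. *)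
Definition pairing f g : dual (injective_tensor E F) :=
  Operator (pairing_subproof f g).

Lemma pairingE f g T : pairing f g T = g (val T f). Proof. by []. Qed.

Lemma norm_pairing f g : `|pairing f g| <= `|f| * `|g|.
Proof.
apply: opnorm_le; first by rewrite mulr_ge0 ?opnorm_ge0.
move=> T; rewrite pairingE (le_trans (ler_opnorm _ _))// -mulrA mulrCA.
rewrite ler_wpM2l ?opnorm_ge0// mulrC; exact: (ler_opnorm (val T) f).
Qed.

(** Weak* sequential continuity in the first variable: it holds for weak*-weakly
    continuous operators, and passes to their closed linear span. *)
Lemma pairing_cvgl (f : nat -> dual E) (f0 : dual E) g (C : R) T :
  (forall n, `|f n| <= C) -> `|f0| <= C ->
  (forall z, (fun n => f n z) @ \oo --> f0 z) ->
  (fun n => pairing (f n) g T) @ \oo --> pairing f0 g T.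
Proof.
move=> fC f0C fz.
pose W := [set T : operator (dual E) F | (fun n => g (T (f n))) @ \oo --> g (T f0)].
suff : closed_span [set T : operator (dual E) F |
    finite_rank T /\ weak_star_weak_continuous T] `<=` W.
  by apply; have := valP T; rewrite unfold_in inE.
have bnd (T' : operator (dual E) F) f' : `|f'| <= C -> `|g (T' f')| <= `|g| * C * `|T'|.
  move=> f'C; rewrite (le_trans (ler_opnorm _ _))// -mulrA ler_wpM2l ?opnorm_ge0//.
  rewrite (le_trans (ler_opnorm _ _))// mulrC ler_wpM2r ?opnorm_ge0//.
apply: smallest_sub; last first.
  move=> T' [_ cT']; rewrite /W/=.
  have ff0 : (f : nat -> weak_star E) @ \oo --> (f0 : weak_star E).
    by apply/initial_cvgP/cvg_sup => z; apply/initial_cvgP; exact: fz.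
  have /weak_cvgP/(_ g) := cvg_comp _ _ ff0 (cT' f0).
  by [].
split.
  apply: (@pointwise_cvg_closed _ _ (fun n (T : operator (dual E) F) => g (T (f n)))
    (fun T : operator (dual E) F => g (T f0)) (`|g| * C)).
  - by move=> n a S S'; rewrite operatorPE linearP.
  - by move=> a S S'; rewrite operatorPE linearP.
  - by move=> n S; exact: bnd.
  - by move=> S; exact: bnd.
apply: (@pointwise_cvg_subspace _ _ (fun n (T : operator (dual E) F) => g (T (f n)))
  (fun T : operator (dual E) F => g (T f0))).
- by move=> n a S S'; rewrite operatorPE linearP.
- by move=> a S S'; rewrite operatorPE linearP.
Qed.

End Tensor.

Lemma wuC_functional (E : normedModType R) (y : nat -> E) (K : R) :
  (forall (eps : nat -> bool) k, `|\sum_(n < k) (-1) ^+ eps n *: y n| <= K) ->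
  forall (f : dual E) k, \sum_(n < k) `|f (y n)| <= `|f| * K.
Proof.
move=> yK f k; pose eps n := f (y n) < 0.
have -> : \sum_(n < k) `|f (y n)| = f (\sum_(n < k) (-1) ^+ eps n *: y n).
  have fZ a v : f (a *: v) = a * f v by rewrite linearZ.
  rewrite linear_sum; apply: eq_bigr => n _; rewrite /= fZ /eps.
  have [fy|fy] := ltP (f (y n) : R) 0.
    by rewrite expr1 mulN1r ltr0_norm.
  by rewrite mul1r ger0_norm.
rewrite (le_trans (ler_norm _))// (le_trans (ler_opnorm _ _))//.
by rewrite ler_wpM2l ?opnorm_ge0.
Qed.

Lemma abs_series_cauchy (u : nat -> R) (K : R) :
  (forall k, \sum_(n < k) `|u n| <= K) ->
  cauchy ((fun k => \sum_(n < k) u n) @ \oo).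
Proof.
move=> uK; apply: cvg_cauchy.
have : cvgn (series u).
  apply: normed_cvg; apply: nondecreasing_is_cvgn.
    by move=> a b ab; apply: nondecreasing_series => // n _ _ /=.
  by exists K => _ [k _ <-]; rewrite /= seriesEord; exact: uK.
by rewrite seriesEord.
Qed.

(** The partial sums on the left have [n] terms where those in the hypothesis
    have [n.+1], whence a shift. *)
Lemma partial_sums_functional_cvg (E : normedModType R) (x y : nat -> E)
    (f : dual E) (c : R) :
  ((fun n => x n - \sum_(k < n.+1) y k) : nat -> weak E) @ \oo
    --> (0 : weak E) ->
  (fun n => f (x n) : R) @ \oo --> c ->
  (fun k => \sum_(n < k) (f (y n) : R)) @ \oo --> c.
Proof.
move=> /weak_cvgP/(_ f) H L; rewrite -cvg_shiftS.
have -> : (fun n => \sum_(k < n.+1) (f (y k) : R)) = (fun n =>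
    (f (x n) : R) - f (x n - \sum_(k < n.+1) y k)).
  apply/funext => n.
  have fB u v : (f (u - v) : R) = f u - f v by exact: linearB.
  have fS : (f (\sum_(k < n.+1) y k) : R) = \sum_(k < n.+1) (f (y k) : R).
    exact: linear_sum.
  by rewrite fB fS subKr.
have f0 : (f 0 : R) = 0 by exact: linear0.
have H0 : (fun n => f (x n - \sum_(k < n.+1) y k) : R) @ \oo --> (0 : R).
  by rewrite -f0; exact: H.
have := cvgB L H0; rewrite subr0; apply.
Qed.

Lemma is_cvg_sum_ord (n : nat) (u : nat -> nat -> R) :
  (forall i, cvgn (u i)) -> cvgn (fun k => \sum_(i < n) u i k).
Proof.
move=> uc; elim: n => [|n IH].
  rewrite (_ : (fun k => _) = fun=> 0); first exact: is_cvg_cst.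
  by apply/funext => k; rewrite big_ord0.
rewrite (_ : (fun k => _) = (fun k => \sum_(i < n) u i k + u n k)); first exact: is_cvgD.
by apply/funext => k; rewrite big_ord_recr.
Qed.

End Pairing.

(** * Functionals given by families of branches *)

Section BranchFunctional.
Context (R : realType).

Lemma segment_sum_eq (S S' : set node) (x : c00 R) :
  (forall phi, x phi != 0 -> (phi \in S) = (phi \in S')) ->
  segment_sum S x = segment_sum S' x.
Proof.
move=> SS'; have [r ur xr] := c00_support x.
rewrite !(segment_sumE _ ur xr) big_mkcond [RHS]big_mkcond/=.
apply: eq_bigr => phi _; have [->|/SS' ->//] := eqVneq (x phi) 0.
by rewrite !if_same.
Qed.

Lemma c00_level (x : c00 R) : exists q, forall phi, x phi != 0 -> (size phi <= q)%N.
Proof.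
have [r ur xr] := c00_support x; exists (\max_(phi <- r) size phi)%N => phi xphi.
have : phi \in r by apply: contraNT xphi => /xr ->.
by move=> phir; exact: (@leq_bigmax_seq _ r xpredT (fun phi : node => size phi)).
Qed.

(** On a finitely supported vector, the branch of [0^i 1 0^n 1] and the branch
    [0^i 1 0 0 0 ...] have the same sum for large [n]. *)
Lemma path_tail_far p i (x : c00 R) : exists N, forall n, (N <= n)%N ->
  segment_sum (path_tail p i (Some n)) x = segment_sum (path_tail p i None) x.
Proof.
have [q xq] := c00_level x; exists q => n qn.
apply: segment_sum_eq => phi /xq phiq.
have E : mkseq (path_bit i (Some n)) (size phi) = mkseq (path_bit i None) (size phi).
  apply/eq_in_map => j; rewrite mem_iota /path_bit => js.
  suff -> : (j == (i + n).+1) = false by [].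
  by apply/eqP; lia.
by apply/idP/idP => /set_mem[A B]; apply/mem_set; split; rewrite // ?E // -E.
Qed.

Variables (M p : nat) (c : nat -> nat).
Hypotheses (c_inj : injective c) (c_lt : forall i, (i < M)%N -> (c i < p)%N).
Implicit Types (nu : nat -> option nat).

(** At level [p > i], the first 1 of the branch [path_bit i o] determines [i]. *)
Lemma path_start_inj i j o o' : (i < p)%N -> (j < p)%N ->
  mkseq (path_bit i o) p = mkseq (path_bit j o') p -> i = j.
Proof.
move=> ip jp E; have nthE k : (k < p)%N -> path_bit i o k = path_bit j o' k.
  by move=> kp; have := congr1 (fun s => nth false s k) E; rewrite !nth_mkseq.
have := nthE i ip; have := nthE j jp; rewrite /path_bit !eqxx/=.
move=> /orP[/eqP ->//|A] /esym/orP[/eqP//|B].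
by case: o {nthE E} A => // n /eqP A; case: o' B => // m /eqP B; lia.
Qed.

Lemma path_segments_admissible nu q : (p <= q)%N ->
  @admissible M (fun i => segment (mkseq (path_bit (c i) (nu i)) p)
                                  (mkseq (path_bit (c i) (nu i)) q)).
Proof.
move=> pq; split; last first.
  exists p, q => i; exists (mkseq (path_bit (c i) (nu i)) p).
  exists (mkseq (path_bit (c i) (nu i)) q).
  by rewrite !size_mkseq prefix_mkseq.
move=> i j _ _ [phi [/andP[A _] /andP[B _]]]; apply/val_inj/c_inj.
have := A; have := B; rewrite !prefixE !size_mkseq => /eqP -> /eqP E.
by apply: path_start_inj (esym E); exact: c_lt.
Qed.

Lemma branch_sum_le nu (x : c00 R) :
  `|\sum_(i < M) segment_sum (path_tail p (c i) (nu i)) x| <= `|x|.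
Proof.
have [q xq] := c00_level x.
have := JH_norm_ge x (path_segments_admissible nu (leq_maxl p q)).
apply: le_trans; rewrite (le_trans (ler_norm_sum _ _ _))//.
apply: ler_sum => i _; rewrite le_eqVlt; apply/orP; left; apply/eqP; congr `|_|.
rewrite -path_tail_segment ?leq_maxl//; apply: segment_sum_eq => phi /xq phiq.
by rewrite in_setI [X in _ && X]mem_set ?andbT//= leq_max phiq orbT.
Qed.

Fact branch_functional_subproof nu :
  (fun x : c00 R => \sum_(i < M) segment_sum (path_tail p (c i) (nu i)) x : R^o)
  \in @bounded_operator R (c00 R) R^o.
Proof.
apply/asboolP; split.
  move=> a x y; rewrite scaler_sumr -big_split/=; apply: eq_bigr => i _.
  by rewrite linearP.
by exists 1 => x; rewrite mul1r; exact: branch_sum_le.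
Qed.

(** The functional [F_nu]: the sum of the values on the branches
    [path_bit (c i) (nu i)], [i < M], from level [p] on. *)
Definition branch_functional nu : dual (c00 R) :=
  Operator (branch_functional_subproof nu).

Lemma branch_functionalE nu x :
  branch_functional nu x = \sum_(i < M) segment_sum (path_tail p (c i) (nu i)) x.
Proof. by []. Qed.

Lemma norm_branch_functional nu : `|branch_functional nu| <= 1.
Proof.
apply: opnorm_le => // x; rewrite mul1r; exact: branch_sum_le.
Qed.

(** Weak* continuity, tested on finitely supported vectors, as one coordinate
    of [nu] tends to infinity. *)
Lemma branch_functional_cvg nu nu0 (l : nat) (x : c00 R) :
  nu0 l = None ->
  (fun n => branch_functional (fun i => if i == l then Some (p + n)%N else nu0 i) x)
    @ \oo --> branch_functional nu0 x.
Proof.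
move=> nul; apply: cvg_near_cst.
have [N xN] := path_tail_far p (c l) x.
exists N => // n Nn; apply: eq_bigr => i _.
by have [->|//] := eqVneq (i : nat) l; rewrite nul xN// (leq_trans Nn)// leq_addl.
Qed.

End BranchFunctional.

(** * Leaf sums *)

Section LeafSums.
Context (R : realType).

(** The vector [u_(i,n)] of [JH]. *)
Definition jh_leaf (i n : nat) : JH R := to_completion (unit_vector R (leaf i n)).

(** The vector [v_i^k], sum of the [u_(i,n)] for [n < k]. *)
Definition leaf_sum (i k : nat) : JH R := \sum_(n < k) jh_leaf i n.

Lemma leaf_sum0 i : leaf_sum i 0 = 0.
Proof. exact: big_ord0. Qed.

Lemma leaf_sumS i k : leaf_sum i k.+1 = leaf_sum i k + jh_leaf i k.
Proof. exact: big_ord_recr. Qed.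

Lemma norm_leaf_combination i k (c : nat -> R) (C : R) : 0 <= C ->
  (forall n, `|c n| <= C) -> `|\sum_(n < k) c n *: jh_leaf i n| <= 2 * C.
Proof.
move=> C0 cC.
have -> : \sum_(n < k) c n *: jh_leaf i n =
    to_completion (\sum_(n < k) c n *: unit_vector R (leaf i n)).
  by rewrite linear_sum; apply: eq_bigr => n _; rewrite linearZ.
by rewrite JH_isometry; exact: leaf_sum_norm.
Qed.

Lemma norm_leaf_sum i k : `|leaf_sum i k| <= 2.
Proof.
have -> : leaf_sum i k = \sum_(n < k) (fun=> 1 : R) n *: jh_leaf i n.
  by apply: eq_bigr => n _; rewrite scale1r.
have n1 (n : nat) : `|1 : R| <= 1 by rewrite normr1.
by have := @norm_leaf_combination i k (fun=> 1) 1 ler01 n1; rewrite mulr1.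
Qed.

Section Branch.
Variables (M p : nat) (c : nat -> nat).
Hypotheses (c_inj : injective c) (c_lt : forall i, (i < M)%N -> (c i < p)%N).
Variable nu : nat -> option nat.
Hypothesis nu_ge : forall i m, (i < M)%N -> nu i = Some m -> (p <= m)%N.

Let f := extend (branch_functional R c_inj c_lt nu).

Lemma branch_jh_leaf i n : f (jh_leaf i n) =
  \sum_(j < M) ((i == c j) && (Some n == nu j))%:R.
Proof.
rewrite /f extendE branch_functionalE; apply: eq_bigr => j _.
rewrite segment_sum_unit_vector leaf_path_tail//.
case nuj : (nu j) => [m|//]; have := nu_ge (ltn_ord j) nuj; lia.
Qed.

Lemma branch_leaf_sum_out i k : (forall j, (j < M)%N -> i != c j) ->
  f (leaf_sum i k) = 0.
Proof.
move=> ic; rewrite linear_sum big1// => n _; rewrite [LHS]branch_jh_leaf big1// => j _.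
by rewrite (negbTE (ic _ _)).
Qed.

Lemma branch_leaf_sum j k : (j < M)%N ->
  f (leaf_sum (c j) k) = if nu j is Some m then (m < k)%:R else 0.
Proof.
move=> jM; rewrite linear_sum.
have E n : f (jh_leaf (c j) n) = (Some n == nu j)%:R.
  rewrite branch_jh_leaf (bigD1 (Ordinal jM))//= eqxx big1 ?addr0// => i ij.
  rewrite (inj_eq c_inj); case: eqVneq => //= ji.
  by rewrite -val_eqE/= ji eqxx in ij.
transitivity (\sum_(n < k) (Some (n : nat) == nu j)%:R : R).
  by apply: eq_bigr => n _; exact: E.
case: (nu j) => [m|]; last by rewrite big1.
case: ltnP => mk.
  rewrite (bigD1 (Ordinal mk))//= eqxx big1 ?addr0// => n.
  by rewrite -val_eqE/= (inj_eq Some_inj) => /negbTE ->.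
by rewrite big1// => n _; rewrite (inj_eq Some_inj) ltn_eqF// (leq_trans _ mk).
Qed.

End Branch.

End LeafSums.

Section AbsoluteMatrix.
Context (R : realType) (M : nat) (a : nat -> nat -> R).
Hypothesis a1 : forall s t : nat -> R, (forall i, `|s i| <= 1) -> (forall j, `|t j| <= 1) ->
  `|\sum_(i < M) \sum_(j < M) a i j * s i * t j| <= 1.

(** A bilinear form of norm at most 1 on [l_infty x l_infty] is an operator of
    norm at most 1 from [l_infty] to [l_1]. *)
Lemma matrix_l1_le (s : nat -> R) (C : R) : 0 <= C -> (forall i, `|s i| <= C) ->
  \sum_(j < M) `|\sum_(i < M) a i j * s i| <= C.
Proof.
move=> C0 sC; have [C00|Cn0] := eqVneq C 0.
  have s0 i : s i = 0 by apply/eqP; rewrite -normr_le0 -C00.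
  rewrite big1 ?C00// => j _; rewrite big1 ?normr0// => i _.
  by rewrite s0 mulr0.
have Cp : 0 < C by rewrite lt_neqAle eq_sym Cn0.
pose t j : R := Num.sg (\sum_(i < M) a i j * s i).
have t1 j : `|t j| <= 1 by rewrite normr_sg; case: (_ != 0).
have s1 i : `|s i / C| <= 1.
  by rewrite normrM normfV (gtr0_norm Cp) ler_pdivrMr// mul1r.
have := a1 s1 t1; rewrite exchange_big/=.
rewrite (_ : \sum_(j < M) _ = (\sum_(j < M) `|\sum_(i < M) a i j * s i|) / C).
  by move=> H; have := le_trans (ler_norm _) H; rewrite ler_pdivrMr// mul1r.
rewrite mulr_suml; apply: eq_bigr => j _.
rewrite normrEsg -/(t j) mulr_sumr mulr_suml; apply: eq_bigr => i _; ring.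
Qed.

End AbsoluteMatrix.

(** * Blocks *)

Section Blocks.
Context (R : realType).

Local Notation JJ := (injective_tensor (JH R) (JH R)).

(** The tensor [v_i^k (x) v_j^k]. *)
Definition leaf_tensor (i j k : nat) : JJ := tensor (leaf_sum R i k) (leaf_sum R j k).

(** Evaluation at [f] of an element of the tensor product, seen as an
    operator. *)
Definition tensor_eval (f : dual (JH R)) (T : JJ) : JH R := val T f.

Fact tensor_eval_linear f : linear (tensor_eval f).
Proof. by move=> b S T; rewrite /tensor_eval closed_span_valP operatorPE. Qed.

HB.instance Definition _ f := GRing.isLinear.Build R JJ (JH R) *:%R
  (tensor_eval f) (tensor_eval_linear f).

Lemma tensor_eval_tensor f z w : tensor_eval f (tensor z w) = f z *: w.
Proof. by []. Qed.

Lemma leaf_tensor_step i j n (f : dual (JH R)) :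
  tensor_eval f (leaf_tensor i j n.+1 - leaf_tensor i j n) =
  f (jh_leaf R i n) *: leaf_sum R j n.+1 + f (leaf_sum R i n) *: jh_leaf R j n.
Proof.
rewrite linearB !/leaf_tensor /= !tensor_eval_tensor.
have -> : f (leaf_sum R i n.+1) = f (leaf_sum R i n) + f (jh_leaf R i n).
  by rewrite leaf_sumS linearD.
by rewrite scalerDl addrAC -scalerBr {1}(leaf_sumS R j) addrAC subrr add0r addrC.
Qed.

(** Because of the identity
    [v_i^(n+1) (x) v_j^(n+1) - v_i^n (x) v_j^n
      = u_(i,n) (x) v_j^(n+1) + v_i^n (x) u_(j,n)]
    the increments form a weakly unconditionally Cauchy series. *)
Lemma leaf_tensor_wuC i j (eps : nat -> bool) k :
  `|\sum_(n < k) (-1) ^+ eps n *: (leaf_tensor i j n.+1 - leaf_tensor i j n)| <= 8.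
Proof.
rewrite closed_span_normE; apply: opnorm_le => // f.
have -> : val (\sum_(n < k) (-1) ^+ eps n *: (leaf_tensor i j n.+1 - leaf_tensor i j n)) f =
    \sum_(n < k) ((-1) ^+ eps n * f (jh_leaf R i n)) *: leaf_sum R j n.+1 +
    \sum_(n < k) ((-1) ^+ eps n * f (leaf_sum R i n)) *: jh_leaf R j n.
  rewrite -[LHS]/(tensor_eval f _) linear_sum -big_split/=; apply: eq_bigr => n _.
  by rewrite linearZ/= leaf_tensor_step scalerDr !scalerA.
have f0 : 0 <= `|f| * 2 by rewrite mulr_ge0.
have fi n : `|f (leaf_sum R i n)| <= `|f| * 2.
  by rewrite (le_trans (ler_opnorm _ _))// ler_wpM2l ?opnorm_ge0// norm_leaf_sum.
have fu : \sum_(n < k) `|f (jh_leaf R i n)| <= `|f| * 2.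
  apply: wuC_functional => e l; rewrite -[leRHS]mulr1.
  apply: (norm_leaf_combination _ _ (c := fun n => (-1) ^+ e n)) => // n.
  by rewrite normrX normrN1 expr1n.
have -> : 8 * `|f| = `|f| * 2 * 2 + 2 * (`|f| * 2) by ring.
rewrite (le_trans (ler_normD _ _))// lerD//.
  rewrite (le_trans (ler_norm_sum _ _ _))// (le_trans _ (ler_wpM2r _ fu))//.
  rewrite mulr_suml; apply: ler_sum => n _.
  by rewrite normrZ normrM normrX normrN1 expr1n mul1r ler_wpM2l// norm_leaf_sum.
apply: (norm_leaf_combination _ _ (c := fun n => (-1) ^+ eps n * f (leaf_sum R i n))) => // n.
by rewrite normrM normrX normrN1 expr1n mul1r.
Qed.

Lemma leaf_tensor_cauchy i j (Phi : dual JJ) :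
  cauchy ((fun k => Phi (leaf_tensor i j k) : R) @ \oo).
Proof.
have -> : (fun k => Phi (leaf_tensor i j k) : R) =
    fun k => \sum_(n < k) Phi (leaf_tensor i j n.+1 - leaf_tensor i j n).
  apply/funext; elim=> [|k IH].
    rewrite big_ord0 -(linear0 Phi); congr (Phi _).
    apply/val_inj/val_inj/funext => f; rewrite [LHS]tensorE (leaf_sum0 R i).
    by rewrite leaf_sum0 scaler0.
  by rewrite big_ord_recr/= -IH linearB addrC subrK.
apply: (@abs_series_cauchy R
  (fun n => Phi (leaf_tensor i j n.+1 - leaf_tensor i j n)) (`|Phi| * 8)) => k.
exact: (@wuC_functional R JJ
  (fun n => leaf_tensor i j n.+1 - leaf_tensor i j n) 8 (@leaf_tensor_wuC i j) Phi k).
Qed.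

Variables (M : nat) (a : nat -> nat -> R) (c : nat -> nat).

(** The tensor [sum_(i,j < M) a_ij v_(c i)^k (x) v_(c j)^k]. *)
Definition block (k : nat) : JJ :=
  \sum_(i < M) \sum_(j < M) a i j *: leaf_tensor (c i) (c j) k.

Lemma block_cauchy (Phi : dual JJ) : cauchy ((fun k => Phi (block k) : R) @ \oo).
Proof.
apply: cvg_cauchy.
have -> : (fun k => Phi (block k) : R) = (fun k => \sum_(i < M) \sum_(j < M)
    a i j * Phi (leaf_tensor (c i) (c j) k)).
  apply/funext => k; rewrite linear_sum; apply: eq_bigr => i _.
  by rewrite linear_sum; apply: eq_bigr => j _; rewrite linearZ.
apply: (@is_cvg_sum_ord R M (fun i k => \sum_(j < M)
  a i j * Phi (leaf_tensor (c i) (c j) k))) => i.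
apply: (@is_cvg_sum_ord R M (fun j k => a i j * Phi (leaf_tensor (c i) (c j) k))) => j.
apply: is_cvgM; first exact: is_cvg_cst.
by apply: cauchy_cvg; exact: leaf_tensor_cauchy.
Qed.

Lemma pairing_block f g k : pairing f g (block k) =
  \sum_(i < M) \sum_(j < M)
    a i j * f (leaf_sum R (c i) k) * g (leaf_sum R (c j) k).
Proof.
rewrite linear_sum; apply: eq_bigr => i _.
rewrite linear_sum; apply: eq_bigr => j _.
rewrite linearZ -mulrA; congr (_ * _).
by rewrite [LHS]pairingE tensorE linearZ.
Qed.

Hypothesis a1 : forall s t : nat -> R, (forall i, `|s i| <= 1) -> (forall j, `|t j| <= 1) ->
  `|\sum_(i < M) \sum_(j < M) a i j * s i * t j| <= 1.

Lemma norm_block k : `|block k| <= 4.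
Proof.
rewrite closed_span_normE; apply: opnorm_le => // f.
have -> : val (block k) f = \sum_(j < M)
    (\sum_(i < M) a i j * f (leaf_sum R (c i) k)) *: leaf_sum R (c j) k.
  rewrite -[LHS]/(tensor_eval f _) /block exchange_big linear_sum/=.
  apply: eq_bigr => j _; rewrite linear_sum scaler_suml; apply: eq_bigr => i _.
  by rewrite linearZ /= tensor_eval_tensor scalerA.
have f0 : 0 <= `|f| * 2 by rewrite mulr_ge0.
have fi n : `|f (leaf_sum R (c n) k)| <= `|f| * 2.
  by rewrite (le_trans (ler_opnorm _ _))// ler_wpM2l ?opnorm_ge0// norm_leaf_sum.
have H := @matrix_l1_le R M a a1 (fun i => f (leaf_sum R (c i) k)) _ f0 (fun i => fi i).
have -> : 4 * `|f| = `|f| * 2 * 2 by ring.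
rewrite (le_trans (ler_norm_sum _ _ _))//.
have H2 : (\sum_(j < M) `|\sum_(i < M) a i j * f (leaf_sum R (c i) k)|) * 2 <=
    `|f| * 2 * 2 by rewrite ler_wpM2r.
rewrite (le_trans _ H2)// mulr_suml.
by apply: ler_sum => j _; rewrite normrZ ler_wpM2l// norm_leaf_sum.
Qed.

End Blocks.

(** * Real sequences and adaptive selection *)

Section Real.
Context (R : realType).

Lemma geometric_sum_le (N k : nat) :
  \sum_(r < k) (2^-1 : R) ^+ (N + r) <= 2 * 2^-1 ^+ N.
Proof.
suff -> : \sum_(r < k) (2^-1 : R) ^+ (N + r) = 2 * 2^-1 ^+ N - 2 * 2^-1 ^+ (N + k).
  by rewrite gerBl mulr_ge0// exprn_ge0// invr_ge0.
elim: k => [|k IH]; first by rewrite big_ord0 addn0 subrr.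
by rewrite big_ord_recr/= IH addnS exprS; field.
Qed.

Lemma dominated_sum_cauchy (u : nat -> nat -> R) (B : R) :
  (forall r, cvgn (u r)) -> (forall r k, `|u r k| <= B * 2^-1 ^+ r) ->
  cauchy ((fun k => \sum_(r < k) u r k) @ \oo).
Proof.
move=> uc uB; apply: cauchy_exP => e e0.
have B0 : 0 <= B.
  by have := le_trans (normr_ge0 _) (uB 0%N 0%N); rewrite expr0 mulr1.
have [N BN] : exists N, B * (2 * 2^-1 ^+ N) < e / 2.
  have h1 : `|2^-1 : R| < 1 by rewrite gtr0_norm ?invr_gt0// invf_lt1// ltr1n.
  have e1 : 0 < e / 2 / (B + 1) / 2 by rewrite !divr_gt0// ltr_wpDl.
  have /cvgrPdist_lt/(_ _ e1)[N _ /(_ N (leqnn N))] := cvg_expr h1.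
  rewrite sub0r normrN => HN; exists N.
  have h0 : 0 <= 2^-1 ^+ N :> R by rewrite exprn_ge0// invr_ge0.
  move: HN; rewrite ger0_norm// ltr_pdivlMr// ltr_pdivlMr ?ltr_wpDl// => HN.
  by rewrite (le_lt_trans _ HN)// mulrC (mulrC _ 2) ler_wpM2l ?mulr_ge0// lerDl.
have /cvg_ex[l ul] : cvgn (fun k => \sum_(r < N) u r k).
  exact: is_cvg_sum_ord.
exists l; have e2 : 0 < e / 2 by rewrite divr_gt0.
move/cvgrPdist_lt : ul => /(_ _ e2) ul.
have NN : \forall k \near \oo, (N <= k)%N by exact: nbhs_infty_ge.
rewrite -[_ _]/(\forall k \near \oo, ball l e (\sum_(r < k) u r k)).
move: NN ul; apply: filterS2 => k Nk lk.
rewrite -ball_normE/= -(subnKC Nk) big_split_ord/= subnKC//.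
rewrite opprD addrA (splitr e) (le_lt_trans (ler_normB _ _))// ltrD//.
rewrite (le_lt_trans _ BN)// (le_trans (ler_norm_sum _ _ _))//.
rewrite (le_trans (ler_sum _ (fun r _ => uB _ _)))//.
by rewrite -mulr_sumr ler_wpM2l// geometric_sum_le.
Qed.

(** Variation of the partial sums of an absolutely convergent series along a
    subsequence. *)
Lemma variation_le (v : nat -> R) (K : R) (kk : nat -> nat) (L : nat) :
  (forall k, \sum_(n < k) `|v n| <= K) ->
  (forall i, (i < L)%N -> (kk i <= kk i.+1)%N) ->
  \sum_(i < L) `|\sum_(n < kk i.+1) v n - \sum_(n < kk i) v n| <= K.
Proof.
move=> vK kkm.
have D k k' : (k <= k')%N -> `|\sum_(n < k') v n - \sum_(n < k) v n| <=
    \sum_(n < k') `|v n| - \sum_(n < k) `|v n|.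
  move=> kk'; rewrite -(subnKC kk') !big_split_ord/= addrAC subrr add0r [leRHS]addrAC subrr add0r.
  exact: ler_norm_sum.
apply: le_trans (vK (kk L)).
elim: L kkm => [|L IH] kkm; first by rewrite big_ord0 sumr_ge0.
rewrite big_ord_recr/=.
have := IH (fun i iL => kkm i (ltnW iL)); have := D _ _ (kkm L (ltnSn L)); lra.
Qed.

(** At every state of stage [l] the limit of [theta k] is [c l], and every state
    of stage [l] is a limit, for each [theta k], of states of stage [l.+1].
    Then a single state, together with increasing indices [kk], realizes all the
    values [c 0], ..., [c L] up to [e]: approximations at finitely many indices
    are kept when moving to a close enough state of the next stage. *)
Lemma adaptive_selection (State : Type) (stage : nat -> State -> Prop)
    (theta : nat -> State -> R) (c : nat -> R) (L : nat) (e : R) : 0 < e ->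
  (exists s, stage 0%N s) ->
  (forall l s, stage l s -> (fun k => theta k s) @ \oo --> c l) ->
  (forall l s, (l < L)%N -> stage l s -> exists t : nat -> State,
     (forall n, stage l.+1 (t n)) /\
     (forall k, (fun n => theta k (t n)) @ \oo --> theta k s)) ->
  exists s (kk : nat -> nat), (forall i, (i < L)%N -> (kk i < kk i.+1)%N) /\
    (forall i, (i <= L)%N -> `|theta (kk i) s - c i| < e).
Proof.
move=> e0 [s0 s0P] cP tP.
suff : forall l, (l <= L)%N -> exists s (kk : nat -> nat), [/\ stage l s,
    (forall i, (i < l)%N -> (kk i < kk i.+1)%N) &
    (forall i, (i <= l)%N -> `|theta (kk i) s - c i| < e)].
  by move=> /(_ L (leqnn L))[s [kk [_ A B]]]; exists s, kk.
elim=> [_|l IH lL].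
  have /cvgrPdist_lt/(_ _ e0)[k _ /(_ k (leqnn k)) sk] := cP _ _ s0P.
  exists s0, (fun=> k); split=> // i; rewrite leqn0 => /eqP ->.
  by rewrite distrC.
have [s [kk [sP kkm kkP]]] := IH (ltnW lL).
have [t [tst tcv]] := tP _ _ lL sP.
have [n nP] : exists n, forall i : 'I_l.+1, `|theta (kk i) (t n) - c i| < e.
  have : \forall n \near \oo, forall i : 'I_l.+1, `|theta (kk i) (t n) - c i| < e.
    apply: filter_forall => i.
    have d0 : 0 < e - `|theta (kk i) s - c i| by rewrite subr_gt0 kkP// -ltnS.
    have /cvgrPdist_lt/(_ _ d0) := tcv (kk i); apply: filterS => n.
    rewrite ltrBrDr distrC => H; apply: le_lt_trans H.
    by rewrite -[X in `|X| <= _](subrKA (theta (kk i) s)) ler_normD.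
  by case=> n _ /(_ n (leqnn n)) nP; exists n.
have [k kkk kP] : exists2 k, (kk l < k)%N & `|theta k (t n) - c l.+1| < e.
  have /cvgrPdist_lt/(_ _ e0)[k _ kP] := cP _ _ (tst n).
  exists (maxn k (kk l).+1); first exact: leq_maxr.
  by rewrite distrC; apply: kP; exact: leq_maxl.
exists (t n), (fun i => if (i <= l)%N then kk i else k); split=> //.
  move=> i il; have -> : (i <= l)%N by rewrite -ltnS.
  have [li|li] := ltnP i l; first exact: kkm.
  by have -> : i = l by lia.
move=> i il; have [li|li] := leqP i l; first exact: (nP (Ordinal (li : (i < l.+1)%N))).
by have -> : i = l.+1 by lia.
Qed.

(** The case where [theta k s] is a partial sum of a series whose absolute
    values have partial sums at most [K]. *)
Lemma variation_of_limits (State : Type) (stage : nat -> State -> Prop)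
    (v : State -> nat -> R) (c : nat -> R) (L : nat) (K : R) :
  (forall s k, \sum_(n < k) `|v s n| <= K) ->
  (exists s, stage 0%N s) ->
  (forall l s, stage l s -> (fun k => \sum_(n < k) v s n) @ \oo --> c l) ->
  (forall l s, (l < L)%N -> stage l s -> exists t : nat -> State,
     (forall n, stage l.+1 (t n)) /\
     (forall k, (fun n => v (t n) k) @ \oo --> v s k)) ->
  \sum_(i < L) `|c i.+1 - c i| <= K.
Proof.
move=> vK s0 cP tP; apply/ler_addgt0Pr => e e0.
have d0 : 0 < e / (2 * L.+1%:R) by rewrite divr_gt0// mulr_gt0.
pose theta k s := \sum_(n < k) v s n.
have [|s [kk [kkm kkP]]] := @adaptive_selection State stage theta c L _ d0 s0 cP.
  move=> l s lL /(tP _ _ lL)[t [tst tcv]]; exists t; split=> // k.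
  rewrite /theta; elim: k => [|k IH].
    rewrite big_ord0 (_ : (fun n => _) = fun=> 0); first exact: cvg_cst.
    by apply/funext => n; rewrite big_ord0.
  rewrite big_ord_recr (_ : (fun n => _) = (fun n => \sum_(i < k) v (t n) i + v (t n) k)).
    exact: cvgD.
  by apply/funext => n; rewrite big_ord_recr.
have H := @variation_le (v s) K kk L (vK s) (fun i iL => ltnW (kkm i iL)).
rewrite (le_trans _ (lerD H (lexx e)))//.
have -> : e = \sum_(i < L.+1) (2 * (e / (2 * L.+1%:R))).
  have N0 : L.+1%:R != 0 :> R by rewrite pnatr_eq0.
  rewrite sumr_const card_ord -[_ *+ _]mulr_natr.
  by move: (L.+1%:R) N0 => N N0; field.
rewrite big_ord_recr/= addrA -big_split/= -[leLHS]addr0 lerD//; last first.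
  by rewrite mulr_ge0// ltW.
apply: ler_sum => i _.
have := kkP i (ltnW (ltn_ord i)); have := kkP i.+1 (ltn_ord i).
rewrite /theta; set x := \sum_(n < _) _; set y := \sum_(n < _) _ => A B.
have -> : c i.+1 - c i = (x - y) - (x - c i.+1) + (y - c i) by ring.
rewrite (le_trans (ler_normD _ _))//.
have := ler_normB (x - y) (x - c i.+1).
by move: (e / _) A B => d A B; lra.
Qed.

Lemma sum_even_le (F : nat -> R) M : (forall i, 0 <= F i) ->
  \sum_(i < M) F i.*2 <= \sum_(l < M.*2) F l.
Proof.
move=> F0; elim: M => [|M IH]; first by rewrite !big_ord0.
by rewrite doubleS !big_ord_recr/= -[leLHS]addr0 lerD// lerD.
Qed.

End Real.

(** * The weakly Cauchy sequence *)

(** The index [code r i] is that of the branch used for row and column [i] of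
    block [r]; distinct blocks use disjoint sets of indices. *)
Definition code (r i : nat) : nat := pickle (r, i).

Lemma code_inj r : injective (code r).
Proof. by move=> i j /(pcan_inj pickleK)[]. Qed.

Lemma code_neq r r' i j : r != r' -> code r i != code r' j.
Proof. by apply: contra_neq => /(pcan_inj pickleK)[]. Qed.

Section Counterexample.
Context (R : realType) (M : nat -> nat) (a : nat -> nat -> nat -> R).

Local Notation JJ := (injective_tensor (JH R) (JH R)).

(** The sequence of the counterexample, for given matrices [a r] of sizes [M r];
    its [k]-th term only involves the first [k] blocks. *)
Definition block_sequence (k : nat) : JJ :=
  \sum_(r < k) (2^-1 : R) ^+ r *: block (M r) (a r) (code r) k.

Lemma block_sequence_apply (Phi : dual JJ) k : Phi (block_sequence k) =
  \sum_(r < k) (2^-1 : R) ^+ r * Phi (block (M r) (a r) (code r) k).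
Proof.
by rewrite linear_sum; apply: eq_bigr => r _; rewrite linearZ.
Qed.

Section WeaklyCauchy.
Hypothesis a1 : forall r (s t : nat -> R), (forall i, `|s i| <= 1) -> (forall j, `|t j| <= 1) ->
  `|\sum_(i < M r) \sum_(j < M r) a r i j * s i * t j| <= 1.

Lemma block_sequence_cauchy :
  cauchy ((block_sequence : nat -> weak JJ) @ \oo).
Proof.
apply/weak_cauchyP => Phi.
have -> : Phi n @[n --> block_sequence @ \oo] =
    (fun k => \sum_(r < k) 2^-1 ^+ r * Phi (block (M r) (a r) (code r) k)) @ \oo.
  rewrite -[LHS]/((fun k => Phi (block_sequence k)) @ \oo); congr (_ @ \oo).
  by apply/funext => k; exact: block_sequence_apply.
apply: (@dominated_sum_cauchy R
  (fun r k => 2^-1 ^+ r * Phi (block (M r) (a r) (code r) k)) (`|Phi| * 4)) => r.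
  apply: is_cvgM; first exact: is_cvg_cst.
  by apply: cauchy_cvg; exact: block_cauchy.
have h0 : 0 <= 2^-1 ^+ r :> R by rewrite exprn_ge0 ?invr_ge0.
move=> k; rewrite normrM (ger0_norm h0) mulrC ler_wpM2r//.
rewrite (le_trans (ler_opnorm _ _))// ler_wpM2l ?opnorm_ge0//.
exact: (norm_block (code r) (a1 r) k).
Qed.

End WeaklyCauchy.

Section Stages.
Variable r : nat.

(** A level from which on the branches of block [r] are disjoint. *)
Definition start_level : nat := (\max_(i < M r) code r i).+1.

Lemma code_lt_start i : (i < M r)%N -> (code r i < start_level)%N.
Proof. by move=> iM; rewrite ltnS (leq_bigmax (Ordinal iM)). Qed.

(** A state [s : nat -> option nat] encodes a pair of functionals [F_nu]: the
    even coordinates of [s] give the one tested on rows, the odd coordinates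
    the one tested on columns. *)
Definition row_functional (s : nat -> option nat) : dual (JH R) :=
  extend (branch_functional R (@code_inj r) code_lt_start (fun i => s i.*2)).

Definition column_functional (s : nat -> option nat) : dual (JH R) :=
  extend (branch_functional R (@code_inj r) code_lt_start (fun i => s i.*2.+1)).

(** At stage [l], exactly the first [l] coordinates are switched on, and their
    values are at least [start_level]. *)
Definition stage (l : nat) (s : nat -> option nat) : Prop := forall t,
  if (t < l)%N then exists2 m, s t = Some m & (start_level <= m)%N else s t = None.

Lemma norm_row_functional s : `|row_functional s| <= 1.
Proof. by apply: le_trans (norm_extend _) _; exact: norm_branch_functional. Qed.

Lemma norm_column_functional s : `|column_functional s| <= 1.
Proof. by apply: le_trans (norm_extend _) _; exact: norm_branch_functional. Qed.

Lemma stage_bound l s : stage l s -> exists B, forall t m, s t = Some m -> (m < B)%N.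
Proof.
move=> sl; exists (\max_(t < l) odflt 0%N (s t)).+1 => t m stm.
have tl : (t < l)%N by have := sl t; case: ifP => // _; rewrite stm.
by rewrite ltnS (leq_trans _ (leq_bigmax (Ordinal tl)))//= stm.
Qed.

Lemma stage_ge l s t m : stage l s -> s t = Some m -> (start_level <= m)%N.
Proof.
by move=> /(_ t) + st; rewrite st; case: ifP => // _ [m' [<-]].
Qed.

(** The limit of the sequence, tested against a state at stage [l]: the sum of
    the entries of block [r] in the rows and columns switched on, times
    [2 ^- r]. *)
Definition stage_value (l : nat) : R :=
  2^-1 ^+ r * \sum_(i < M r) \sum_(j < M r)
    a r i j * (i.*2 < l)%:R * (j.*2.+1 < l)%:R.

Lemma stage_indicator l s t k : stage l s ->
  (forall t m, s t = Some m -> (m < k)%N) ->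
  (if s t is Some m then (m < k)%:R else 0) = (t < l)%:R :> R.
Proof.
move=> /(_ t) sl sk; case: ifP sl => [_ [m stm _]|_ ->//].
by rewrite stm (sk _ _ stm).
Qed.

Lemma pairing_block_sequence l s : stage l s -> exists N, forall k, (N <= k)%N ->
  pairing (row_functional s) (column_functional s) (block_sequence k) = stage_value l.
Proof.
move=> sl; have [B sB] := stage_bound sl.
exists (maxn r.+1 B) => k; rewrite geq_max => /andP[rk Bk].
have sk t m : s t = Some m -> (m < k)%N by move=> /sB mB; exact: leq_trans Bk.
have rowge i m : (i < M r)%N -> s i.*2 = Some m -> (start_level <= m)%N.
  by move=> _; exact: stage_ge sl.
have colge i m : (i < M r)%N -> s i.*2.+1 = Some m -> (start_level <= m)%N.
  by move=> _; exact: stage_ge sl.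
rewrite block_sequence_apply.
transitivity (\sum_(r' < k) (if r' == r :> nat then stage_value l else 0)); last first.
  rewrite (bigD1 (Ordinal rk))//= eqxx big1 ?addr0// => r'.
  by rewrite -val_eqE/= => /negbTE ->.
apply: eq_bigr => r' _; rewrite pairing_block; case: eqVneq => [->|rr'].
  congr (_ * _); apply: eq_bigr => i _; apply: eq_bigr => j _.
  rewrite (branch_leaf_sum _ _ _ rowge)// (branch_leaf_sum _ _ _ colge)//.
  by rewrite !(stage_indicator _ sl sk).
rewrite big1 ?mulr0// => i _; rewrite big1// => j _.
rewrite (branch_leaf_sum_out _ _ _ rowge) ?mulr0 ?mul0r// => j' _.
exact: code_neq.
Qed.

Lemma stage_cvg l s (y : nat -> JJ) : stage l s ->
  ((fun n => block_sequence n - \sum_(k < n.+1) y k) : nat -> weak JJ) @ \oo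
    --> (0 : weak JJ) ->
  (fun k => \sum_(n < k) (pairing (row_functional s) (column_functional s) (y n) : R)) @ \oo
    --> stage_value l.
Proof.
move=> sl ylim; apply: partial_sums_functional_cvg ylim _.
apply: cvg_near_cst; have [N NP] := pairing_block_sequence sl.
by exists N => // n; exact: NP.
Qed.

Lemma stage_next l s : (l < (M r).*2)%N -> stage l s ->
  exists t : nat -> nat -> option nat, (forall n, stage l.+1 (t n)) /\
  forall T : JJ, (fun n => pairing (row_functional (t n)) (column_functional (t n)) T : R)
    @ \oo --> pairing (row_functional s) (column_functional s) T.
Proof.
move=> lM sl.
pose t n i := if i == l then Some (start_level + n)%N else s i.
have sNone : s l = None by have := sl l; rewrite ltnn.
exists t; split=> [n i|T].
  rewrite /t; have [->|il] := eqVneq i l.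
    by rewrite ltnSn; exists (start_level + n)%N => //; exact: leq_addr.
  have -> : (i < l.+1)%N = (i < l)%N by rewrite ltnS leq_eqVlt (negbTE il).
  exact: sl.
have fC n : `|row_functional (t n)| <= 1 by exact: norm_row_functional.
have f0C : `|row_functional s| <= 1 by exact: norm_row_functional.
(* If l is odd the step concerns column l./2, otherwise row l./2. *)
have lE : l = (odd l + l./2.*2)%N by rewrite odd_double_half.
case: (boolP (odd l)) => ol; rewrite ?ol ?(negbTE ol)/= in lE.
  have -> : (fun n => pairing (row_functional (t n)) (column_functional (t n)) T : R) =
      (fun n => column_functional (t n) (val T (row_functional s))).
    apply/funext => n; rewrite pairingE; congr (_ (val T _)).
    congr (extend (branch_functional _ _ _ _)); apply/funext => i.
    by rewrite /t; case: eqP => // il; move: ol; rewrite -il odd_double.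
  apply: (@extend_cvg _ _ (fun n => branch_functional R (@code_inj r) code_lt_start _)
    (branch_functional R (@code_inj r) code_lt_start _) 1).
  - by move=> n; exact: norm_branch_functional.
  - exact: norm_branch_functional.
  move=> x; have tE n : (fun i => t n i.*2.+1) = fun i =>
      if i == l./2 then Some (start_level + n)%N else s i.*2.+1.
    by apply/funext => i; rewrite /t {1}lE add1n eqSS (inj_eq double_inj).
  under eq_fun => n do rewrite tE.
  apply: (@branch_functional_cvg _ _ _ _ _ _ (fun i => s i.*2.+1)).
  by rewrite -add1n -lE.
have -> : (fun n => pairing (row_functional (t n)) (column_functional (t n)) T : R) =
    (fun n => pairing (row_functional (t n)) (column_functional s) T).
  apply/funext => n; congr (pairing _ _ T).
  congr (extend (branch_functional _ _ _ _)); apply/funext => i.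
  by rewrite /t; case: eqP => // il; move: ol; rewrite -il/= odd_double.
apply: pairing_cvgl fC f0C _ => z.
apply: (@extend_cvg _ _ (fun n => branch_functional R (@code_inj r) code_lt_start _)
  (branch_functional R (@code_inj r) code_lt_start _) 1).
- by move=> n; exact: norm_branch_functional.
- exact: norm_branch_functional.
move=> x; have tE n : (fun i => t n i.*2) = fun i =>
    if i == l./2 then Some (start_level + n)%N else s i.*2.
  by apply/funext => i; rewrite /t {1}lE add0n (inj_eq double_inj).
under eq_fun => n do rewrite tE.
apply: (@branch_functional_cvg _ _ _ _ _ _ (fun i => s i.*2)).
by rewrite -[X in s X]add0n -lE.
Qed.

Lemma stage_value_step i : (i < M r)%N ->
  stage_value i.*2.+1 - stage_value i.*2 = 2^-1 ^+ r * \sum_(j < i) a r i j.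
Proof.
move=> iM; rewrite /stage_value -mulrBr; congr (_ * _).
rewrite -sumrB (bigD1 (Ordinal iM))//= [X in _ + X]big1 ?addr0; last first.
  move=> i' i'i; rewrite -sumrB big1// => j _.
  have -> : (i'.*2 < i.*2.+1)%N = (i'.*2 < i.*2)%N.
    by move: i'i; rewrite -val_eqE/=; lia.
  have -> : (j.*2.+1 < i.*2.+1)%N = (j.*2.+1 < i.*2)%N by lia.
  by rewrite subrr.
rewrite -sumrB (big_ord_widen _ (fun j => a r i j) (ltnW iM)) [RHS]big_mkcond/=.
apply: eq_bigr => j _; rewrite ltnn ltnSn mulr0 mul0r subr0 mulr1.
have -> : (j.*2.+1 < i.*2.+1)%N = (j < i)%N by lia.
by case: ifP; rewrite ?mulr1 ?mulr0.
Qed.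

(** The stages [2 i] and [2 i + 1] differ by the lower part of row [i], so that
    the lower triangle is bounded by the variation of the stage values. *)
Lemma block_variation (y : nat -> JJ) (K : R) :
  (forall (eps : nat -> bool) k, `|\sum_(n < k) (-1) ^+ eps n *: y n| <= K) ->
  ((fun n => block_sequence n - \sum_(k < n.+1) y k) : nat -> weak JJ) @ \oo
    --> (0 : weak JJ) ->
  2^-1 ^+ r * \sum_(i < M r) \sum_(j < i) a r i j <= K.
Proof.
move=> yK ylim.
have K0 : 0 <= K by rewrite (le_trans _ (yK (fun=> true) 0%N)).
have H : \sum_(l < (M r).*2) `|stage_value l.+1 - stage_value l| <= K.
  apply: (@variation_of_limits R _ stage
    (fun s n => pairing (row_functional s) (column_functional s) (y n))).
  - move=> s k.
    apply: le_trans (wuC_functional yK (pairing (row_functional s) (column_functional s)) k) _.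
    rewrite -[leRHS]mul1r ler_wpM2r// (le_trans (norm_pairing _ _))//.
    by rewrite -[leRHS]mulr1 ler_pM ?opnorm_ge0 ?norm_row_functional ?norm_column_functional.
  - by exists (fun=> None) => t.
  - by move=> l s sl; exact: stage_cvg.
  move=> l s lM sl; have [t [tst tcv]] := stage_next lM sl.
  by exists t; split=> // k; exact: tcv.
apply: le_trans H; rewrite mulr_sumr.
apply: le_trans (@sum_even_le R (fun l => `|stage_value l.+1 - stage_value l|) (M r) _) => //.
by apply: ler_sum => i _; rewrite stage_value_step// ler_norm.
Qed.

End Stages.

End Counterexample.

Theorem theorem4 (R : realType) :
  ~ property_u (injective_tensor (JH R) (JH R)).
Proof.
pose good (r : nat) (Ma : nat * (nat -> nat -> R)) :=
  (forall s t : nat -> R, (forall i, `|s i| <= 1) -> (forall j, `|t j| <= 1) ->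
    `|\sum_(i < Ma.1) \sum_(j < Ma.1) Ma.2 i j * s i * t j| <= 1) /\
  (4 ^ r)%:R <= \sum_(i < Ma.1) \sum_(j < i) Ma.2 i j.
have /choice[Ma MaP] r : exists Ma, good r Ma.
  have [|M [a [a1 a2]]] := @triangle_unbounded R (4 ^ r)%N; first by rewrite expn_gt0.
  by exists (M, a).
pose M r := (Ma r).1; pose a r := (Ma r).2.
move=> /(_ (block_sequence M a)).
case=> [|y [K yK] ylim].
  by apply: block_sequence_cauchy => r; exact: (MaP r).1.
have bound r : 2 ^+ r <= K.
  have := block_variation r yK ylim; apply: le_trans.
  rewrite (le_trans _ (ler_wpM2l _ (MaP r).2))//; last by rewrite exprn_ge0 ?invr_ge0.
  by rewrite natrX -exprMn (_ : 2^-1 * 4%:R = 2)//; field.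
have := bound (Num.truncn K).+1.
apply/negP; rewrite -ltNge.
have := truncnS_gt K => /lt_le_trans; apply.
rewrite -natrX ler_nat; exact/ltnW/ltn_expl.
Qed.
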